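(* Let $\mathcal{C}$ be a plane algebraic curve over $\mathbb{C}$ with an infinity branch $B$. A plane algebraic curve $\overline{\mathcal{C}}$ approaches $\mathcal{C}$ at $B$ if and only if $\overline{\mathcal{C}}$ has an infinity branch $\overline{B}$ such that $B$ and $\overline{B}$ are convergent.
   Context: An algebraic plane curve $\mathcal{C}$ is the set of complex zeros in $\mathbb{C}^2$ of an irreducible polynomial $f(x,y)\in\mathbb{R}[x,y]$. Let $F(x,y,z)\in\mathbb{R}[x,y,z]$ be the homogenization of $f$ and $\mathcal{C}^*\subset\mathbb{P}^2(\mathbb{C})$ the corresponding projective curve; an infinity point of $\mathcal{C}$ is a point of $\mathcal{C}^*$ with $z=0$. Standing assumption: for every curve considered, $(0:1:0)$ is not an infinity point, i.e. all infinity points have the form $(1:m:0)$ with $m\in\mathbb{C}$. Infinity branches. Let $P=(1:m:0)$ be an infinity point of $\mathcal{C}$ and let $g(y,z)=F(1,y,z)$. Let $\varphi(z)=m+a_1z^{N_1/N}+a_2z^{N_2/N}+\cdots$ (a finite or infinite sum, $a_i\neq 0$, $N,N_i\in\mathbb{N}$, $0<N_1<N_2<\cdots$) be a Puiseux series with $g(\varphi(z),z)=0$, where $N$ is the ramification index of $\varphi$ (the least common denominator of its exponents). Put $r(z)=z\varphi(z^{-1})=mz+a_1z^{1-N_1/N}+a_2z^{1-N_2/N}+\cdots$. Its conjugates are $r_j(z)=mz+a_1c_j^{N_1}z^{1-N_1/N}+a_2c_j^{N_2}z^{1-N_2/N}+\cdots$, $j=1,\dots,N$, where $c_1,\dots,c_N$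 are the $N$ complex roots of $x^N=1$. Let $M\in\mathbb{R}^+$ be such that these series converge for $|z|>M$; then $f(z,r_j(z))=0$ for $|z|>M$. The set $B=\bigcup_{j=1}^N L_j$ with $L_j=\{(z,r_j(z))\in\mathbb{C}^2: z\in\mathbb{C},\ |z|>M\}$ is an infinity branch of $\mathcal{C}$ associated to $P$, and the $L_j$ are its leaves. Convention: fractional powers are evaluated with one fixed determination, $z^{1/N}=\exp(\mathrm{Log}(z)/N)$ with $\mathrm{Log}$ the principal logarithm, and $z^{1-k/N}=z\,(z^{1/N})^{-k}$. Two leaves $L=\{(z,r(z)): |z|>M\}$ and $\overline{L}=\{(z,\overline{r}(z)): |z|>\overline{M}\}$ are convergent if $\lim_{z\to\infty}(\overline{r}(z)-r(z))=0$, where $z\to\infty$ in $\mathbb{C}$ means $|z|\to\infty$. Two infinity branches $B$ and $\overline{B}$ are convergent if there exist two convergent leaves $L\subset B$ and $\overline{L}\subset\overline{B}$. With $d$ the Euclidean distance on $\mathbb{C}^2$, the distance from a point $p\in\mathbb{C}^2$ to a curve $\mathcal{C}$ is $d(p,\mathcal{C})=\min\{d(p,q): q\in\mathcal{C}\}$. A curve $\overline{\mathcal{C}}$ approaches $\mathcal{C}$ at its infinity branch $B$ if there exists one leaf $L=\{(z,r(z))\in\mathbb{C}^2: z\in\mathbb{C},\ |z|>M\}\subset B$ such that $\lim_{z\to\infty}d((z,r(z)),\overline{\mathcal{C}})=0$. *)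

(* Defs.v *)
From HB Require Import structures.
From mathcomp Require Import all_boot all_order all_algebra.
From mathcomp Require Import all_classical all_reals all_analysis complex.

Set Implicit Arguments.
Unset Strict Implicit.
Unset Printing Implicit Defensive.

Import Order.TTheory GRing.Theory Num.Theory numFieldNormedType.Exports.
Import Normc.

Local Open Scope classical_set_scope.
Local Open Scope ring_scope.
Local Open Scope complex_scope.

(* The topology of R[i] is the one every numFieldType K carries through K^o. *)
#[export, non_forgetful_inheritance]
HB.instance Definition _ (R : realType) := NormedModule.copy R[i] (R[i])^o.

Definition irreducible_elt (A : idomainType) (f : A) : Prop :=
  [/\ f != 0, f \isn't a GRing.unit &
      forall g h, f = g * h -> g \is a GRing.unit \/ h \is a GRing.unit].

(* f : {poly {poly R}} stands for the polynomial
   f(x, y) = \sum_j \sum_i f`_j`_i x ^ i y ^ j: the outer variable is y. *)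

Definition total_degree (R : nzRingType) (f : {poly {poly R}}) : nat :=
  \max_(j < size f) \max_(i < size (f`_j)%R | (f`_j`_i != 0)%R) (i + j).

(* The homogenization F of f, evaluated at a point (x, y, z) of a commutative
   ring A into which the coefficients are mapped by phi. *)
Definition homogenization (R : nzRingType) (f : {poly {poly R}})
    (A : comNzRingType) (phi : {rmorphism R -> A}) (x y z : A) : A :=
  \sum_(j < size f) \sum_(i < size f`_j)
    phi f`_j`_i * x ^+ i * y ^+ j * z ^+ (total_degree f - (i + j)).

Section Complex.
Variable R : realType.
Local Notation C := R[i].

(* Principal determination, with values in ]-pi, pi]. *)
Definition Arg (z : C) : R :=
  let t := acos (complex.Re z / normc z) in if 0 <= complex.Im z then t else - t.

Definition Log (z : C) : C := ln (normc z) +i* Arg z.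

Definition Cexp (z : C) : C :=
  (expR (complex.Re z))%:C * (cos (complex.Im z) +i* sin (complex.Im z)).

Lemma CexpK (z : C) : z != 0 -> Cexp (Log z) = z.
Proof.
move=> z0; have n0 : 0 < normc z.
  rewrite lt_neqAle eq_sym; apply/andP; split; last by case: (z) => a b; exact: sqrtr_ge0.
  by apply: contra z0 => /eqP /eq0_normc ->.
rewrite /Cexp /Log/= lnK ?posrE//.
case: z z0 n0 => a b z0 n0; set n := normc _ in n0 *.
have nE : n ^+ 2 = a ^+ 2 + b ^+ 2 by rewrite sqr_sqrtr ?addr_ge0 ?sqr_ge0.
have tE : (a / n) ^+ 2 + (b / n) ^+ 2 = 1.
  by rewrite !expr_div_n -mulrDl -nE divff// expf_neq0// gt_eqF.
have ti : -1 <= a / n <= 1.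
  by rewrite -ler_norml -[leRHS]normr1 -ler_sqr ?nnegrE// normr1 expr1n
    real_normK ?num_real// -tE lerDl sqr_ge0.
rewrite /Arg/= -/n.
have sE : sin (acos (a / n)) = `|b| / n.
  rewrite sin_acos// -tE addrAC subrr add0r sqrtr_sqr normrM normfV.
  by rewrite (gtr0_norm n0).
have e t s : n%:C * (t +i* s) = (n * t) +i* (n * s).
  by simpc.
have nx0 : n != 0 by rewrite gt_eqF.
case: leP => b0; rewrite e ?cosN ?sinN sE acosK ?in_itv//=.
  by rewrite ger0_norm// !(mulrC n) !divfK.
by rewrite ltr0_norm// mulNr opprK !(mulrC n) !divfK.
Qed.

Definition principal_root (N : nat) (z : C) : C := Cexp (Log z / N%:R).

Definition Cinfty_nbhs : set_system C :=
  [set A | exists M : R, forall z : C, M < normc z -> A z].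

Global Instance Cinfty_nbhs_filter : ProperFilter Cinfty_nbhs.
Proof.
split; first by case=> M /(_ ((`|M| + 1)%:C)); apply;
  rewrite /= expr0n addr0 sqrtr_sqr ger0_norm ?addr_ge0// ltr_pwDr// ler_norm.
split; first by exists 0.
- move=> P Q [M MP] [M' MQ]; exists (Num.max M M') => z.
  by rewrite gt_max => /andP[/MP Pz /MQ Qz].
- by move=> P Q PQ [M MP]; exists M => z /MP /PQ.
Qed.

Definition euclid_dist (p q : C * C) : R :=
  Num.sqrt (normc (p.1 - q.1) ^+ 2 + normc (p.2 - q.2) ^+ 2).

Definition dist_to (S : set (C * C)) (p : C * C) : R :=
  inf [set euclid_dist p q | q in S].

Definition curve (f : {poly {poly R}}) : set (C * C) :=
  [set p | (map_poly (map_poly (real_complex R)) f).[p.2%:P].[p.1] = 0].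

(* f is the irreducible equation of a plane algebraic curve for which (0:1:0)
   is not an infinity point. *)
Definition plane_curve (f : {poly {poly R}}) : Prop :=
  irreducible_elt f /\ homogenization f (real_complex R) 0 1 0 <> 0.

Definition infinity_point (f : {poly {poly R}}) (m : C) : Prop :=
  homogenization f (real_complex R) 1 m 0 = 0.

(* The pair (c, N) encodes phi(z) = \sum_k c k z ^ (k / N). *)

(* N is the least common denominator of the exponents k / N of phi:
   d is a common denominator when every d k / N is an integer. *)
Definition ramification_index (c : nat -> C) (N : nat) : Prop :=
  (0 < N)%N /\
  forall d, (0 < d)%N -> (forall k, c k != 0 -> (N %| d * k)%N) -> (N <= d)%N.

(* The identity F(1, phi(z), z) = 0 of formal Puiseux series. With z = t ^ N it
   is an identity of power series in t, and the coefficient of t ^ n in its left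
   side only involves the terms of phi of order at most n in t. *)
Definition puiseux_solution (f : {poly {poly R}}) (c : nat -> C) (N : nat) :
    Prop :=
  forall n, (homogenization f (polyC \o real_complex R)
               1 (\poly_(k < n.+1) c k) 'X^N)`_n = 0.

(* Terms c_k w ^ k z ^ (1 - k / N) of the conjugate of r(z) = z phi(1 / z)
   attached to the root of unity w. *)
Definition conjugate_term (c : nat -> C) (N : nat) (w z : C) (k : nat) : C :=
  c k * w ^+ k * (z * (principal_root N z) ^- k).

Record infinity_branch (f : {poly {poly R}}) := InfinityBranch {
  ramif : nat;
  coefs : nat -> C;
  radius : R;
  branch_point : infinity_point f (coefs 0);
  branch_ramif : ramification_index coefs ramif;
  branch_solution : puiseux_solution f coefs ramif;
  radius_gt0 : 0 < radius;
  branch_cvg : forall w z, w ^+ ramif = 1 -> radius < normc z ->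
    cvgn (series (conjugate_term coefs ramif w z)) }.

Record leaf := Leaf { leaf_radius : R; leaf_fun : C -> C }.

Definition leaf_set (L : leaf) : set (C * C) :=
  [set p | leaf_radius L < normc p.1 /\ p.2 = leaf_fun L p.1].

Definition leaves f (B : infinity_branch f) : set leaf :=
  [set Leaf (radius B)
         (fun z => limn (series (conjugate_term (coefs B) (ramif B) w z)))
     | w in [set w : C | w ^+ ramif B = 1]].

Definition branch_set f (B : infinity_branch f) : set (C * C) :=
  \bigcup_(L in leaves B) leaf_set L.

Definition convergent_leaves (L L' : leaf) : Prop :=
  leaf_fun L' z - leaf_fun L z @[z --> Cinfty_nbhs] --> (0 : C).

Definition convergent_branches f g (B : infinity_branch f)
    (B' : infinity_branch g) : Prop :=
  exists L L', [/\ leaves B L, leaves B' L' & convergent_leaves L L'].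

Definition approaches (S : set (C * C)) f (B : infinity_branch f) : Prop :=
  exists2 L, leaves B L &
    dist_to S (z, leaf_fun L z) @[z --> Cinfty_nbhs] --> (0 : R).

Lemma horner2_continuous (P : {poly {poly C}}) :
  continuous (fun q : C * C => P.[q.2%:P].[q.1]).
Proof.
have ch (p : {poly C}) : continuous (fun q : C * C => p.[q.1]).
  elim/poly_ind: p => [|p c IHp] q.
    by under eq_fun do rewrite horner0; exact: cvg_cst.
  under eq_fun do rewrite hornerMXaddC.
  apply: cvgD; last exact: cvg_cst.
  by apply: cvgM; [exact: IHp|exact: cvg_fst].
elim/poly_ind: P => [|P c IHP] q.
  by under eq_fun do rewrite horner0 horner0; exact: cvg_cst.
under eq_fun do rewrite hornerMXaddC hornerD hornerM hornerC.
apply: cvgD; last exact: ch.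
by apply: cvgM; [exact: IHP|exact: cvg_snd].
Qed.

Lemma sqrD_le_norm (x y : R) : x ^+ 2 + y ^+ 2 <= (`|x| + `|y|) ^+ 2.
Proof.
by rewrite sqrrD !real_normK ?num_real// lerD2r lerDl mulrn_wge0// mulr_ge0.
Qed.

Lemma complex_continuous : continuous (fun u : R * R => u.1 +i* u.2 : C).
Proof.
move=> u; apply/cvgrPdist_lt => e.
case: e => a b; rewrite ltcE/= => /andP[/eqP b0 a0]; rewrite b0.
have a2 : 0 < a / 2 by rewrite divr_gt0.
have c1 : fst @ nbhs u --> u.1 by exact: cvg_fst.
have c2 : snd @ nbhs u --> u.2 by exact: cvg_snd.
near=> v.
rewrite normc_def -[a +i* 0]/(a%:C) ltcR/=.
have h1 : `|u.1 - v.1| < a / 2 by near: v; move/cvgr_dist_lt: c1; apply.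
have h2 : `|u.2 - v.2| < a / 2 by near: v; move/cvgr_dist_lt: c2; apply.
apply: (@le_lt_trans _ _ (`|u.1 - v.1| + `|u.2 - v.2|)); last first.
  by rewrite (splitr a) ltrD.
rewrite -[leRHS]ger0_norm ?addr_ge0// -sqrtr_sqr ler_wsqrtr//.
exact: sqrD_le_norm.
Unshelve. all: by end_near. Qed.

Lemma curve_closed (f : {poly {poly R}}) : closed (curve f).
Proof.
have -> : curve f = (fun q : C * C =>
    (map_poly (map_poly (real_complex R)) f).[q.2%:P].[q.1]) @^-1` [set 0] by [].
apply: preimage_closed; last exact: (@accessible_closed_set1 _ (hausdorff_accessible (@norm_hausdorff _ C))).
by move=> q _; exact: horner2_continuous.
Qed.

Lemma normc_ge_comp (z : C) :
  `|complex.Re z| <= normc z /\ `|complex.Im z| <= normc z.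
Proof.
case: z => a b /=; split; rewrite -[leLHS]ger0_norm// -sqrtr_sqr ler_wsqrtr//;
  by rewrite real_normK ?num_real// (lerDl, lerDr) sqr_ge0.
Qed.

Lemma euclid_dist_ge (p q : C * C) :
  normc (p.1 - q.1) <= euclid_dist p q /\ normc (p.2 - q.2) <= euclid_dist p q.
Proof.
have n0 (z : C) : 0 <= normc z by case: z => a b; exact: sqrtr_ge0.
split; rewrite -[leLHS]ger0_norm ?n0// -sqrtr_sqr ler_wsqrtr//;
  by rewrite (lerDl, lerDr) sqr_ge0.
Qed.

Lemma dist_to_min_closed (S : set (C * C)) (p : C * C) : closed S -> S !=set0 ->
  exists2 q, S q & euclid_dist p q = dist_to S p /\
                   forall q', S q' -> euclid_dist p q <= euclid_dist p q'.
Proof.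
move=> Scl [q0 Sq0].
pose h (u : (R * R) * (R * R)) : C * C := (u.1.1 +i* u.1.2, u.2.1 +i* u.2.2).
have hc : continuous h.
  move=> u; pose k (v : R * R) : C := v.1 +i* v.2.
  have c1 : (k \o fst) v @[v --> nbhs u] --> (k \o fst) u.
    apply: (@continuous_comp (R * R * (R * R))%type (R * R)%type C fst k).
      exact: cvg_fst.
    exact: complex_continuous.
  have c2 : (k \o snd) v @[v --> nbhs u] --> (k \o snd) u.
    apply: (@continuous_comp (R * R * (R * R))%type (R * R)%type C snd k).
      exact: cvg_snd.
    exact: complex_continuous.
  exact: (cvg_pair c1 c2).
pose D := euclid_dist p q0.
pose I (x : R) := [set` `[x - D, x + D]].
pose K := h @^-1` S `&` ((I (complex.Re p.1) `*` I (complex.Im p.1))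
                  `*` (I (complex.Re p.2) `*` I (complex.Im p.2))).
have inK u : S (h u) -> euclid_dist p (h u) <= D -> K u.
  move=> Su uD; split => //.
  have [l1 l2] := euclid_dist_ge p (h u).
  have [r1 i1] := normc_ge_comp (p.1 - (h u).1).
  have [r2 i2] := normc_ge_comp (p.2 - (h u).2).
  have H (x y t : R) : `|x - y| <= t -> t <= D -> I x y.
    move=> h1 h2; rewrite /I/= in_itv/= -ler_distlC distrC.
    by rewrite distrC (le_trans h1).
  move: p.1 p.2 r1 i1 r2 i2 l1 l2 => [a b] [c d] /= r1 i1 r2 i2 l1 l2.
  by do 2!split => /=; [apply: H r1 _|apply: H i1 _|apply: H r2 _|apply: H i2 _];
     apply: le_trans uD.
have surjh (q : C * C) : exists u, h u = q.
  by case: q => [[a b] [c d]]; exists ((a, b), (c, d)).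
have Kc : compact K.
  apply: (@subclosed_compact _ _ ((I (complex.Re p.1) `*` I (complex.Im p.1))
                  `*` (I (complex.Re p.2) `*` I (complex.Im p.2)))).
  - apply: closedI; first by apply: preimage_closed => // u _; exact: hc.
    by apply: compact_closed; [exact: norm_hausdorff|];
      do !apply: compact_setX; exact: segment_compact.
  - by do !apply: compact_setX; exact: segment_compact.
  - exact: subIsetr.
have [u0 hu0] := surjh q0.
have K0 : K !=set0 by exists u0; apply: inK; rewrite hu0.
have dc : continuous (fun u => euclid_dist p (h u)).
  move=> u.
  have -> : (fun u => euclid_dist p (h u)) = Num.sqrt \o (fun u =>
    (complex.Re p.1 - u.1.1) ^+ 2 + (complex.Im p.1 - u.1.2) ^+ 2 +
   ((complex.Re p.2 - u.2.1) ^+ 2 + (complex.Im p.2 - u.2.2) ^+ 2)).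
    apply/funext => v; rewrite /euclid_dist /h /=.
    case: p.1 p.2 => [a b] [c d] /=.
    by rewrite !sqr_sqrtr ?addr_ge0 ?sqr_ge0.
  have H (c : R) (g : (R * R) * (R * R) -> R) : g @ nbhs u --> g u ->
      (c - g v) ^+ 2 @[v --> nbhs u] --> (c - g u) ^+ 2.
    move=> gu; rewrite expr2; under eq_fun do rewrite expr2.
    by apply: cvgM; (apply: cvgB; [exact: cvg_cst|]).
  apply: (@continuous_comp _ R R); last exact: sqrt_continuous.
  apply: cvgD; apply: cvgD; apply: H.
  - by apply: (@continuous_comp _ (R * R)%type R fst fst); exact: cvg_fst.
  - by apply: (@continuous_comp _ (R * R)%type R fst snd); [exact: cvg_fst|exact: cvg_snd].
  - by apply: (@continuous_comp _ (R * R)%type R snd fst); [exact: cvg_snd|exact: cvg_fst].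
  - by apply: (@continuous_comp _ (R * R)%type R snd snd); exact: cvg_snd.
have [w /set_mem Kw wmin] := compact_EVT_min K0 Kc (continuous_subspaceT dc).
have wmin' q' : S q' -> euclid_dist p (h w) <= euclid_dist p q'.
  move=> Sq'; have [u hu] := surjh q'; rewrite -hu.
  have [uD|/ltW Du] := leP (euclid_dist p (h u)) D.
    by apply: wmin; apply/mem_set/inK; rewrite // hu.
  apply: le_trans Du; rewrite /D -hu0; apply: wmin; apply/mem_set/inK; rewrite hu0//.
exists (h w); first by case: Kw.
split=> //; apply/esym/eqP; rewrite eq_le; apply/andP; split.
  apply: ge_inf; last by exists (h w) => //; case: Kw.
  by exists (euclid_dist p (h w)) => _ [q' Sq' <-]; exact: wmin'.
apply: lb_le_inf; first by exists (euclid_dist p q0), q0.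
by move=> _ [q' Sq' <-]; exact: wmin'.
Qed.

Lemma plane_curve_nonempty (f : {poly {poly R}}) :
  plane_curve f -> curve f !=set0.
Proof.
case=> -[f0 fU _] F010.
have [j [fj0 dj]] : exists j, f`_j`_0 != 0 /\ (total_degree f <= j)%N.
  apply: contrapT => nj; apply: F010; rewrite /homogenization.
  rewrite big1// => j _; rewrite big1// => i _.
  have [i0|i0] := eqVneq (i : nat) 0%N; last by rewrite expr0n (negbTE i0) mulr0 !mul0r.
  have [->|c0] := eqVneq f`_j`_i 0; first by rewrite rmorph0 !mul0r.
  rewrite [X in _ * X]expr0n subn_eq0 i0.
  case: leqP => jd; last by rewrite mulr0.
  by case: nj; exists j; rewrite -i0.
have small k l : f`_k`_l != 0 -> (l + k <= total_degree f)%N.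
  move=> c0; have ks : (k < size f)%N.
    by rewrite ltnNge; apply: contra c0 => /(nth_default 0) ->; rewrite coef0.
  have ls : (l < size (f`_k)%R)%N.
    by rewrite ltnNge; apply: contra c0 => /(nth_default 0) ->.
  rewrite /total_degree (bigD1 (Ordinal ks))//= (bigD1 (Ordinal ls))//=.
  by rewrite !leq_max leqnn.
have j0 : j != 0%N.
  apply: contra fU => /eqP jE; move: dj; rewrite jE leqn0 => /eqP d0.
  have -> : f = (f`_0`_0)%:P%:P.
    apply/polyP => k; apply/polyP => l; rewrite coefC.
    have [->|k0] := eqVneq k 0%N.
      rewrite coefC; have [->//|l0] := eqVneq l 0%N.
      apply/eqP/negPn/negP => /small; rewrite d0 addn0 leqn0; exact/negP.
    rewrite coef0; apply/eqP/negPn/negP => /small.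
    by rewrite d0 leqn0 addn_eq0 (negbTE k0) andbF.
  by do 2!apply: rmorph_unit; rewrite unitfE; move: fj0; rewrite jE.
pose P := map_poly (map_poly (real_complex R)) f.
pose p := map_poly (horner_eval (0 : C)) P.
have pj : p`_j != 0.
  rewrite coef_map/= /horner_eval horner_coef0 coef_map/= coef_map/=.
  by rewrite fmorph_eq0.
have /closed_rootP[y] : size p != 1.
  apply: contra j0 => /eqP s1; move: pj; rewrite -leqn0 leqNgt; apply: contra => j0.
  by rewrite nth_default// s1.
move=> /rootP py; exists (0, y); rewrite /curve/=.
have /= := horner_map (horner_eval (0 : C)) P y%:P.
by rewrite -/p [horner_eval _ y%:P]hornerC py => /esym.
Qed.
(* The infimum defining the distance to a curve is a minimum. *)
Lemma dist_to_min (f : {poly {poly R}}) (p : C * C) : plane_curve f ->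
  exists2 q, curve f q & euclid_dist p q = dist_to (curve f) p /\
    forall q', curve f q' -> euclid_dist p q <= euclid_dist p q'.
Proof.
move=> fP; apply: dist_to_min_closed; first exact: curve_closed.
exact: plane_curve_nonempty.
Qed.

Lemma leaf_subset f (B : infinity_branch f) L :
  leaves B L -> leaf_set L `<=` branch_set B.
Proof. by move=> BL p Lp; exists L. Qed.

End Complex.

(* Main.v *)
Require Import Defs.
From HB Require Import structures.
From mathcomp Require Import all_boot all_order all_algebra.
From mathcomp Require Import all_classical all_reals all_analysis complex.
From mathcomp Require Import ring lra.

(** Puiseux's theorem with convergence is proved over the ring of convergent
    power series in t. If the multiplicity m of the root u = 0 of H(u, 0) is
    positive, the implicit function theorem applied to the (m - 1)-st
    u-derivative gives a convergent shift after which H has no term in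
    u ^ (m - 1); the first edge of the Newton polygon then has a root of
    multiplicity less than m, and one concludes by induction on m.

    If the curve of fbar approaches B, let Phi be the part of the Puiseux series
    of B that contributes the terms of nonnegative degree in z, and let
    t ^ N = 1 / z. The equation F(1, Phi(t) + t ^ N u, t ^ N) = 0 of the second
    curve, divided by the largest possible power of t, has zeros (u, t)
    arbitrarily close to (0, 0): the points of the curve close to the leaf, which
    may lie over a z' different from z, because z Phi(t) varies little with z.
    Hence it has a Puiseux solution with u(0) = 0, and this is a branch whose
    leaf differs from that of B by u and a tail, both tending to 0. *)

Set Implicit Arguments.
Unset Strict Implicit.
Unset Printing Implicit Defensive.

Import Order.TTheory GRing.Theory Num.Theory numFieldNormedType.Exports.
Import Normc.

Local Open Scope ring_scope.

(** * Formal power series *)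

Section PowerSeries.
Variable K : comNzRingType.

(** A wrapper around the coefficient function, so that multiplication is the Cauchy product and not
    the pointwise one. *)
Record fps := Fps { coefps :> nat -> K }.

Lemma fpsP (a b : fps) : a =1 b -> a = b.
Proof. by case: a b => [a] [b] /= /funext ->. Qed.

HB.instance Definition _ := gen_eqMixin fps.
HB.instance Definition _ := gen_choiceMixin fps.

Definition trunc n (a : fps) : {poly K} := \poly_(k < n.+1) a k.

Lemma coef_trunc n a k : (k <= n)%N -> (trunc n a)`_k = a k.
Proof. by move=> kn; rewrite coef_poly ltnS kn. Qed.

Definition addps (a b : fps) := Fps (fun n => a n + b n).
Definition oppps (a : fps) := Fps (fun n => - a n).
(** Each coefficient is read off a product of truncations, which reduces the ring axioms to those of
    [{poly K}]. *)
Definition mulps (a b : fps) := Fps (fun n => (trunc n a * trunc n b)`_n).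
Definition fps_of_poly (p : {poly K}) := Fps (fun n => p`_n).

Lemma coefM_eq n (p p' q q' : {poly K}) :
  (forall k, (k <= n)%N -> p`_k = p'`_k) ->
  (forall k, (k <= n)%N -> q`_k = q'`_k) -> (p * q)`_n = (p' * q')`_n.
Proof.
move=> pp qq; rewrite !coefM; apply: eq_bigr => i _.
by rewrite pp ?qq// ?leq_subr// -ltnS.
Qed.

Lemma mulps_trunc n N (a b : fps) : (n <= N)%N ->
  mulps a b n = (trunc N a * trunc N b)`_n.
Proof.
move=> nN; apply: coefM_eq => k kn; rewrite !coef_trunc//;
  exact: leq_trans nN.
Qed.

Fact addpsA : associative addps.
Proof. by move=> a b c; apply: fpsP => n /=; rewrite addrA. Qed.
Fact addpsC : commutative addps.
Proof. by move=> a b; apply: fpsP => n /=; rewrite addrC. Qed.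
Fact add0ps : left_id (Fps (fun=> 0)) addps.
Proof. by move=> a; apply: fpsP => n /=; rewrite add0r. Qed.
Fact addNps : left_inverse (Fps (fun=> 0)) oppps addps.
Proof. by move=> a; apply: fpsP => n /=; rewrite addNr. Qed.

HB.instance Definition _ := GRing.isZmodule.Build fps addpsA addpsC add0ps addNps.

Fact mulpsC : commutative mulps.
Proof. by move=> a b; apply: fpsP => n /=; rewrite mulrC. Qed.
Fact mulpsA : associative mulps.
Proof.
move=> a b c; apply: fpsP => n /=.
transitivity ((trunc n a * (trunc n b * trunc n c))`_n).
  by apply: coefM_eq => // k kn; rewrite coef_trunc// (mulps_trunc _ _ kn).
rewrite mulrA; apply: coefM_eq => // k kn.
by rewrite coef_trunc// (mulps_trunc _ _ kn).
Qed.
Fact mul1ps : left_id (fps_of_poly 1) mulps.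
Proof.
move=> a; apply: fpsP => n /=.
have -> : a n = (1 * trunc n a)`_n by rewrite mul1r coef_trunc.
by apply: coefM_eq => // k kn; rewrite coef_trunc.
Qed.
Fact mulpsDl : left_distributive mulps addps.
Proof.
move=> a b c; apply: fpsP => n /=; rewrite -coefD -mulrDl.
by apply: coefM_eq => // k kn; rewrite coefD !coef_trunc.
Qed.
Fact oneps_neq0 : fps_of_poly 1 != 0.
Proof.
apply/eqP => /(congr1 (fun a : fps => a 0%N)) /=.
by rewrite coef1 => /eqP; rewrite oner_eq0.
Qed.

HB.instance Definition _ := GRing.Zmodule_isComNzRing.Build fps
  mulpsA mulpsC mul1ps mulpsDl oneps_neq0.

Lemma coefpsD (a b : fps) n : (a + b) n = a n + b n. Proof. by []. Qed.
Lemma coefpsN (a : fps) n : (- a) n = - a n. Proof. by []. Qed.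
Lemma coefpsB (a b : fps) n : (a - b) n = a n - b n. Proof. by []. Qed.
Lemma coefps0 n : (0 : fps) n = 0. Proof. by []. Qed.
Lemma coefps1 n : (1 : fps) n = (n == 0%N)%:R.
Proof. by rewrite /= coef1. Qed.
Lemma coefpsM_trunc n N (a b : fps) : (n <= N)%N ->
  (a * b) n = (trunc N a * trunc N b)`_n.
Proof. exact: mulps_trunc. Qed.
Lemma coefpsM (a b : fps) n : (a * b) n = \sum_(i < n.+1) a i * b (n - i)%N.
Proof.
rewrite (@coefpsM_trunc n n)// coefM; apply: eq_bigr => i _.
by rewrite !coef_trunc ?leq_subr// -ltnS.
Qed.
Lemma coefps_sum I (r : seq I) (P : pred I) (F : I -> fps) n :
  (\sum_(i <- r | P i) F i) n = \sum_(i <- r | P i) F i n.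
Proof. exact: (big_morph (fun a : fps => a n)). Qed.

Lemma fps_of_poly_additive : additive fps_of_poly.
Proof. by move=> p q; apply: fpsP => n /=; rewrite coefB. Qed.
HB.instance Definition _ := GRing.isAdditive.Build {poly K} fps fps_of_poly fps_of_poly_additive.
Lemma fps_of_poly_multiplicative : multiplicative fps_of_poly.
Proof.
split=> // p q; apply: fpsP => n.
rewrite (@coefpsM_trunc n n)//=.
by apply: coefM_eq => k kn; rewrite coef_trunc.
Qed.
HB.instance Definition _ := GRing.isMultiplicative.Build {poly K} fps
  fps_of_poly fps_of_poly_multiplicative.

Definition const_coef (a : fps) := a 0%N.
Lemma const_coef_additive : additive const_coef. Proof. by []. Qed.
HB.instance Definition _ := GRing.isAdditive.Build fps K const_coef const_coef_additive.
Lemma const_coef_multiplicative : multiplicative const_coef.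
Proof.
split; last by rewrite /const_coef coefps1.
by move=> a b; rewrite /const_coef coefpsM big_ord1.
Qed.
HB.instance Definition _ := GRing.isMultiplicative.Build fps K const_coef const_coef_multiplicative.

Definition Xps n := fps_of_poly 'X^n.
Definition Cps c := fps_of_poly c%:P.
Definition shiftps j (a : fps) := Fps (fun n => a (n + j)%N).

Lemma XpsD m n : Xps (m + n) = Xps m * Xps n.
Proof. by rewrite /Xps exprD rmorphM. Qed.
Lemma XpsX m n : Xps m ^+ n = Xps (m * n).
Proof. by rewrite /Xps -rmorphXn -exprM. Qed.

Lemma coefXpsM j (a : fps) n :
  (Xps j * a) n = if (n < j)%N then 0 else a (n - j)%N.
Proof.
rewrite (@coefpsM_trunc n n)//.
transitivity (('X^j * trunc n a)`_n).
  by apply: coefM_eq => // k kn; rewrite coef_trunc.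
by rewrite coefXnM; case: ltnP => // jn; rewrite coef_trunc// leq_subr.
Qed.

Lemma coefCpsM c (a : fps) n : (Cps c * a) n = c * a n.
Proof.
rewrite (@coefpsM_trunc n n)//.
transitivity ((c%:P * trunc n a)`_n).
  by apply: coefM_eq => // k kn; rewrite coef_trunc.
by rewrite coefCM coef_trunc.
Qed.

Lemma shiftpsK j (a : fps) : (forall k, (k < j)%N -> a k = 0) ->
  Xps j * shiftps j a = a.
Proof.
move=> a0; apply: fpsP => n; rewrite coefXpsM.
by case: ltnP => [/a0//|jn] /=; rewrite subnK.
Qed.

Definition eqmod n (a b : fps) := forall k, (k < n)%N -> a k = b k.

Lemma eqmod_refl n a : eqmod n a a. Proof. by []. Qed.
Lemma eqmod_trunc n a : eqmod n.+1 (fps_of_poly (trunc n a)) a.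
Proof. by move=> k kn /=; rewrite coef_trunc. Qed.
Lemma eqmodM n a b c d : eqmod n a b -> eqmod n c d -> eqmod n (a * c) (b * d).
Proof.
move=> ab cd k kn; rewrite !coefpsM; apply: eq_bigr => i _.
by rewrite ab ?cd// (leq_ltn_trans _ kn)// ?leq_subr// -ltnS.
Qed.
Lemma eqmodX n a b m : eqmod n a b -> eqmod n (a ^+ m) (b ^+ m).
Proof.
move=> ab; elim: m => [|m IH]; first by rewrite !expr0.
by rewrite !exprS; exact: eqmodM.
Qed.
Lemma eqmod_sum n I (r : seq I) (P : pred I) (F G : I -> fps) :
  (forall i, eqmod n (F i) (G i)) ->
  eqmod n (\sum_(i <- r | P i) F i) (\sum_(i <- r | P i) G i).
Proof. by move=> FG k kn; rewrite !coefps_sum; apply: eq_bigr => i _; exact: FG. Qed.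

(* The substitution t -> t ^ (q + 1). *)
Definition dilate q (a : fps) :=
  Fps (fun n => if (q.+1 %| n)%N then a (n %/ q.+1)%N else 0).

Lemma coef_dilate_mul q a k : dilate q a (k * q.+1) = a k.
Proof. by rewrite /= dvdn_mull// mulnK. Qed.

Lemma dilate_poly q p : dilate q (fps_of_poly p) = fps_of_poly (p \Po 'X^(q.+1)).
Proof. by apply: fpsP => n /=; rewrite coef_comp_poly_Xn. Qed.

Lemma eqmod_dilate n q a b : eqmod n a b -> eqmod n (dilate q a) (dilate q b).
Proof.
move=> ab k kn /=; case: ifP => // _; apply: ab.
by apply: leq_ltn_trans kn; exact: leq_div.
Qed.

Lemma dilate_additive q : additive (dilate q).
Proof. by move=> a b; apply: fpsP => n /=; case: ifP => // _; rewrite subrr. Qed.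
HB.instance Definition _ q := GRing.isAdditive.Build fps fps (dilate q) (dilate_additive q).
Lemma dilate_multiplicative q : multiplicative (dilate q).
Proof.
split; last by rewrite (dilate_poly q 1) rmorph1.
move=> a b; apply: fpsP => n.
(* The coefficient of index n depends only on the truncations at n, and on polynomials dilation is
   composition with a power of X. *)
have tr x := @eqmod_dilate _ q _ _ (@eqmod_trunc n x).
rewrite -(eqmod_dilate q (eqmodM (@eqmod_trunc n a) (@eqmod_trunc n b)))//.
rewrite -(eqmodM (tr a) (tr b))//.
by rewrite -rmorphM !dilate_poly -rmorphM comp_polyM.
Qed.
HB.instance Definition _ q := GRing.isMultiplicative.Build fps fps
  (dilate q) (dilate_multiplicative q).

Lemma dilate0 a : dilate 0 a = a.
Proof. by apply: fpsP => n /=; rewrite dvd1n divn1. Qed.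

Lemma dilate_inj q : injective (dilate q).
Proof.
move=> a b ab; apply: fpsP => n.
by rewrite -(coef_dilate_mul q a) -(coef_dilate_mul q b) ab.
Qed.

(** The predecessor comes from the index shift: [dilate q] substitutes t ^ (q + 1), which excludes t
    ^ 0. *)
Lemma dilate_comp p q a : dilate p (dilate q a) = dilate (p.+1 * q.+1).-1 a.
Proof.
have : (p.+1 * q.+1).-1.+1 = (p.+1 * q.+1)%N by rewrite prednK ?muln_gt0.
move: (_.-1) => r e; apply: fpsP => n /=; rewrite {}e.
have [/dvdnP[m ->]|pn] := boolP (p.+1 %| n)%N; last first.
  by case: ifP => // /(dvdn_trans (dvdn_mulr _ (dvdnn _))); rewrite (negbTE pn).
by rewrite mulnK// [(m * _)%N]mulnC dvdn_pmul2l// divnMl.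
Qed.

Lemma dilate_Xps q n : dilate q (Xps n) = Xps (n * q.+1).
Proof. by rewrite /Xps dilate_poly rmorphXn /= comp_polyX -exprM mulnC. Qed.

Lemma dilate_Cps q c : dilate q (Cps c) = Cps c.
Proof. by rewrite /Cps dilate_poly comp_polyC. Qed.

Lemma const_dilate q a : const_coef (dilate q a) = const_coef a.
Proof. by rewrite /const_coef /= div0n. Qed.

End PowerSeries.

(** * Homogenization under ring morphisms, congruences and scaling *)

Section Homogenization.
Variables (R : nzRingType) (f : {poly {poly R}}).

Lemma homogenization_rmorph (A B : comNzRingType) (phi : {rmorphism R -> A})
    (psi : {rmorphism A -> B}) x y z :
  psi (homogenization f phi x y z) =
  homogenization f (psi \o phi) (psi x) (psi y) (psi z).
Proof.
rewrite /homogenization rmorph_sum; apply: eq_bigr => j _.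
rewrite rmorph_sum; apply: eq_bigr => i _.
by rewrite !rmorphM !rmorphXn.
Qed.

Lemma homogenization_eqphi (A : comNzRingType) (phi psi : {rmorphism R -> A}) x y z :
  phi =1 psi -> homogenization f phi x y z = homogenization f psi x y z.
Proof.
by move=> e; do 2!(apply: eq_bigr => ? _); rewrite e.
Qed.

Lemma homogenization_eqmod (K : comNzRingType) (phi : {rmorphism R -> fps K})
    n x x' y y' z z' : eqmod n x x' -> eqmod n y y' -> eqmod n z z' ->
  eqmod n (homogenization f phi x y z) (homogenization f phi x' y' z').
Proof.
move=> xx yy zz; apply: eqmod_sum => j; apply: eqmod_sum => i.
exact: (eqmodM (eqmodM (eqmodM (@eqmod_refl _ n _) (eqmodX _ xx)) (eqmodX _ yy)) (eqmodX _ zz)).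
Qed.

Lemma homogenizationZ (A : comNzRingType) (phi : {rmorphism R -> A}) l x y z :
  homogenization f phi (l * x) (l * y) (l * z) =
  l ^+ total_degree f * homogenization f phi x y z.
Proof.
rewrite /homogenization mulr_sumr; apply: eq_bigr => j _.
rewrite mulr_sumr; apply: eq_bigr => i _.
have [->|fij] := eqVneq f`_j`_i 0; first by rewrite rmorph0; ring.
have ij : (i + j <= total_degree f)%N.
  rewrite /total_degree (bigD1 j)//= (bigD1 i)//=.
  by rewrite !leq_max leqnn.
rewrite -[in l ^+ _](subnKC ij) !exprD !exprMn; ring.
Qed.

End Homogenization.

(** * Convergent power series *)

Section Convergent.
Variable R : realType.
Local Notation C := R[i].
Implicit Types (a b u v : fps C) (rho A : R).

Lemma normc_ge0 (z : C) : 0 <= normc z.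
Proof. by case: z => x y; exact: sqrtr_ge0. Qed.

Lemma normcX (z : C) n : normc (z ^+ n) = normc z ^+ n.
Proof. by elim: n => [|n IH]; rewrite ?normc1// !exprS normcM IH. Qed.

Lemma normc_sum I (r : seq I) (P : pred I) (F : I -> C) :
  normc (\sum_(i <- r | P i) F i) <= \sum_(i <- r | P i) normc (F i).
Proof.
elim/big_ind2 : _ => [|x1 x2 y1 y2 h1 h2|//]; first by rewrite normc0.
exact: le_trans (le_normcD _ _) (lerD h1 h2).
Qed.

(** Partial sums of the l1 norm with weight rho. The norm is submultiplicative, and boundedness in n
    expresses absolute convergence on the closed disc of radius rho. *)
Definition wnorm rho a n := \sum_(k < n) normc (a k) * rho ^+ k.

Lemma wnorm_ge0 rho a n : 0 <= rho -> 0 <= wnorm rho a n.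
Proof.
by move=> r0; apply: sumr_ge0 => k _; rewrite mulr_ge0 ?normc_ge0 ?exprn_ge0.
Qed.

Lemma wnormD rho a b n : 0 <= rho ->
  wnorm rho (a + b) n <= wnorm rho a n + wnorm rho b n.
Proof.
move=> r0; rewrite -big_split/=; apply: ler_sum => k _.
by rewrite -mulrDl ler_wpM2r ?exprn_ge0// le_normcD.
Qed.

Lemma wnorm0 rho n : wnorm rho 0 n = 0.
Proof. by rewrite /wnorm big1// => k _; rewrite normc0 mul0r. Qed.

Lemma wnormN rho a n : wnorm rho (- a) n = wnorm rho a n.
Proof. by apply: eq_bigr => k _; rewrite coefpsN normcN. Qed.

Lemma wnorm_sum rho n I (r : seq I) (P : pred I) (F : I -> fps C) : 0 <= rho ->
  wnorm rho (\sum_(i <- r | P i) F i) n <= \sum_(i <- r | P i) wnorm rho (F i) n.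
Proof.
move=> r0; elim/big_ind2 : _ => [|x1 x2 y1 y2 h1 h2|//]; first by rewrite wnorm0.
exact: le_trans (wnormD _ _ _ r0) (lerD h1 h2).
Qed.

(** The terms of the Cauchy product of degree below n come from pairs i + j < n, which are among the
    pairs on the right; all terms there are nonnegative. *)
Lemma wnormM rho a b n : 0 <= rho ->
  wnorm rho (a * b) n <= wnorm rho a n * wnorm rho b n.
Proof.
move=> r0; pose x i := normc (a i) * rho ^+ i; pose y i := normc (b i) * rho ^+ i.
have y0 i : 0 <= y i by rewrite mulr_ge0 ?normc_ge0 ?exprn_ge0.
have x0 i : 0 <= x i by rewrite mulr_ge0 ?normc_ge0 ?exprn_ge0.
apply: (@le_trans _ _ (\sum_(k < n) \sum_(i < n | (i < k.+1)%N) x i * y (k - i)%N)).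
  apply: ler_sum => k _.
  rewrite -(big_ord_widen n (fun i => x i * y (k - i)%N))//.
  rewrite coefpsM; apply: le_trans (ler_wpM2r (exprn_ge0 _ r0) (normc_sum _ _ _)) _.
  rewrite mulr_suml; apply: ler_sum => i _.
  rewrite -[X in rho ^+ X](@subnKC i k) -1?ltnS// exprD normcM /x /y.
  by rewrite mulrACA.
rewrite (exchange_big_dep xpredT)//= mulr_suml; apply: ler_sum => i _.
rewrite -mulr_sumr ler_wpM2l//.
have -> : \sum_(k < n | (i < k.+1)%N) y (k - i)%N = \sum_(i <= k < n) y (k - i)%N.
  by rewrite big_geq_mkord.
rewrite -{1}[nat_of_ord i]add0n big_addn.
rewrite big_mkord; under eq_bigr do rewrite addnK.
rewrite (big_ord_widen n (fun k => y k)) ?leq_subr//.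
rewrite -[leRHS]/(\sum_(k < n) y k).
by rewrite [leRHS](bigID (fun k : 'I_n => (k < n - i)%N))/= lerDl sumr_ge0.
Qed.

Lemma wnorm_le rho rho' a n : 0 <= rho' -> rho' <= rho ->
  wnorm rho' a n <= wnorm rho a n.
Proof.
move=> r0 rr; apply: ler_sum => k _; rewrite ler_wpM2l ?normc_ge0//.
by rewrite lerXn2r// nnegrE (le_trans r0).
Qed.

(** Every term has degree at least 1 and so gains a factor theta. This makes the coefficients of
    index 0 and 1 small in the fixed point argument. *)
Lemma wnormMl rho theta a n : 0 <= rho -> 0 <= theta <= 1 -> a 0%N = 0 ->
  wnorm (theta * rho) a n <= theta * wnorm rho a n.
Proof.
move=> r0 /andP[t0 t1] a0; rewrite mulr_sumr; apply: ler_sum => -[[|k] kn] _ /=.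
  by rewrite a0 normc0 !mul0r mulr0.
rewrite mulrCA ler_wpM2l ?normc_ge0// exprMn ler_wpM2r ?exprn_ge0//.
by rewrite exprS ler_piMr// exprn_ile1.
Qed.

Definition convps : {pred fps C} := fun a =>
  `[< exists2 rho, 0 < rho & exists A, forall n, wnorm rho a n <= A >].

Lemma convpsP a : reflect
  (exists2 rho, 0 < rho & exists A, forall n, wnorm rho a n <= A) (a \in convps).
Proof. exact: asboolP. Qed.

Lemma convps_geo a A r : 0 < r -> (forall k, normc (a k) <= A * r ^+ k) ->
  a \in convps.
Proof.
move=> r0 ar; apply/convpsP; exists (2^-1 / r); first by rewrite divr_gt0.
exists (2 * A) => n.
have A0 : 0 <= A.
  by have := ar 0%N; rewrite expr0 mulr1; exact/le_trans/normc_ge0.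
apply: (@le_trans _ _ (\sum_(k < n) A * 2^-1 ^+ k)).
  apply: ler_sum => k _; apply: le_trans (ler_wpM2r _ (ar k)) _.
    by rewrite exprn_ge0// divr_ge0// ltW.
  by rewrite -mulrA -exprMn mulrCA divff ?gt_eqF// mulr1.
rewrite -mulr_sumr mulrC ler_wpM2r//.
have : \sum_(k < n) (2^-1 : R) ^+ k = 2 - 2 * 2^-1 ^+ n.
  elim: n => [|n IH]; first by rewrite big_ord0 expr0; ring.
  by rewrite big_ord_recr/= IH exprS; field.
by move=> ->; rewrite gerBl mulr_ge0// exprn_ge0// invr_ge0.
Qed.

Lemma wnorm_coef rho A a k : 0 < rho -> (forall n, wnorm rho a n <= A) ->
  normc (a k) * rho ^+ k <= A.
Proof.
move=> r0 /(_ k.+1); apply: le_trans; rewrite /wnorm big_ord_recr/= lerDr.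
exact: wnorm_ge0 (ltW r0).
Qed.

(** The rate r is taken at least 1 so that r ^ (k / (q + 1)) <= r ^ k, which lets dilated series
    keep the bound. *)
Lemma convps_geoP a : a \in convps ->
  exists A r, [/\ 0 <= A, 1 <= r & forall k, normc (a k) <= A * r ^+ k].
Proof.
move=> /convpsP[rho r0 [A Ar]]; exists A, (Num.max 1 rho^-1).
split; [|by rewrite le_max lexx|].
  by have := Ar 0%N; rewrite /wnorm big_ord0.
move=> k; have := wnorm_coef k r0 Ar.
rewrite -ler_pdivlMr ?exprn_gt0// => /le_trans; apply.
apply: ler_wpM2l; first by have := Ar 0%N; rewrite /wnorm big_ord0.
by rewrite -exprVn lerXn2r ?nnegrE ?le_max ?ler01 ?lexx ?orbT// invr_ge0 ltW.
Qed.

Lemma convps_poly p : fps_of_poly p \in convps.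
Proof.
apply: (@convps_geo _ (\sum_(k < size p) normc p`_k) 1) => // k.
rewrite expr1n mulr1 /=.
have [kp|/(nth_default 0) ->] := ltnP k (size p); last first.
  by rewrite normc0 sumr_ge0// => ? _; exact: normc_ge0.
rewrite (bigD1 (Ordinal kp))//= lerDl sumr_ge0// => ? _; exact: normc_ge0.
Qed.

Lemma convps_common a b : a \in convps -> b \in convps -> exists2 rho, 0 < rho &
  exists A, forall n, wnorm rho a n <= A /\ wnorm rho b n <= A.
Proof.
move=> /convpsP[r r0 [A Ar]] /convpsP[r' r'0 [A' Ar']].
have m0 : 0 < Num.min r r' by rewrite lt_min r0.
exists (Num.min r r') => //; exists (Num.max A A') => n; rewrite !le_max.
split; first by rewrite (le_trans (wnorm_le _ _ (ltW m0) _) (Ar n))// ge_min lexx.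
by rewrite (le_trans (wnorm_le _ _ (ltW m0) _) (Ar' n)) ?orbT// ge_min lexx orbT.
Qed.

Lemma convps_subring : subring_closed convps.
Proof.
split; first by rewrite (_ : 1 = fps_of_poly 1)// convps_poly.
- move=> a b ca cb; have [rho r0 [A Ar]] := convps_common ca cb.
  apply/convpsP; exists rho => //; exists (A + A) => n; have [h1 h2] := Ar n.
  by apply: le_trans (wnormD _ _ _ (ltW r0)) _; rewrite wnormN lerD.
- move=> a b ca cb; have [rho r0 [A Ar]] := convps_common ca cb.
  apply/convpsP; exists rho => //; exists (A * A) => n; have [h1 h2] := Ar n.
  apply: le_trans (wnormM _ _ _ (ltW r0)) _.
  by rewrite ler_pM// wnorm_ge0// ltW.
Qed.
HB.instance Definition _ := GRing.isSubringClosed.Build (fps C) convps convps_subring.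

Lemma convps_X n : Xps C n \in convps. Proof. exact: convps_poly. Qed.
Lemma convps_C c : Cps c \in convps. Proof. exact: convps_poly. Qed.

Lemma convps_dilate q a : a \in convps -> dilate q a \in convps.
Proof.
move=> /convps_geoP[A [r [A0 r1 ar]]].
apply: (@convps_geo _ A r); first exact: lt_le_trans r1.
move=> k /=; case: ifP => _; last by rewrite normc0 mulr_ge0// exprn_ge0// (le_trans _ r1).
by apply: le_trans (ar _) _; rewrite ler_wpM2l// ler_weXn2l// leq_div.
Qed.

Lemma convps_shift j a : a \in convps -> shiftps j a \in convps.
Proof.
move=> /convps_geoP[A [r [A0 r1 ar]]].
apply: (@convps_geo _ (A * r ^+ j) r); first exact: lt_le_trans r1.
by move=> k /=; rewrite -mulrA -exprD addnC; exact: ar.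
Qed.

Lemma polyOver_convps_bound (G : {poly fps C}) : G \is a polyOver convps ->
  exists2 rho, 0 < rho & exists2 A, 0 <= A & forall i n, wnorm rho G`_i n <= A.
Proof.
move=> /allP; elim: (G : seq (fps C)) => [|a s IH] Gs.
  by exists 1 => //; exists 0 => // i n; rewrite nth_nil wnorm0.
have [|rho r0 [A A0 Ar]] := IH; first by move=> b bs; apply: Gs; rewrite inE bs orbT.
have /convpsP[r' r'0 [A' Ar']] : a \in convps by apply: Gs; rewrite mem_head.
have m0 : 0 < Num.min rho r' by rewrite lt_min r0.
exists (Num.min rho r') => //; exists (Num.max A A'); first by rewrite le_max A0.
move=> [|i] n /=; rewrite le_max.
  by rewrite (le_trans (wnorm_le _ _ (ltW m0) _) (Ar' n)) ?orbT// ge_min lexx orbT.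
by rewrite (le_trans (wnorm_le _ _ (ltW m0) _) (Ar i n))// ge_min lexx.
Qed.

Lemma eqmod0M n a b : eqmod n a 0 -> b 0%N = 0 -> eqmod n.+1 (a * b) 0.
Proof.
move=> a0 b0 k; rewrite ltnS => kn; rewrite coefpsM big1// => i _.
have ik : (i <= k)%N by rewrite -ltnS.
have [lt_in|le_ni] := ltnP i n; first by rewrite a0// mul0r.
have -> : nat_of_ord i = k by apply/eqP; rewrite eqn_leq ik (leq_trans kn).
by rewrite subnn b0 mulr0.
Qed.

(** a ^ i - b ^ i is a multiple of a - b, with a cofactor vanishing at t = 0 when i >= 2; for i = 1
    the coefficient of G vanishes there. Evaluation of G thus gains one order of t-adic
    precision. *)
Lemma eqmod_horner n (G : {poly fps C}) a b :
  G`_1 0%N = 0 -> a 0%N = 0 -> b 0%N = 0 ->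
  eqmod n a b -> eqmod n.+1 G.[a] G.[b].
Proof.
move=> G1 a0 b0 ab.
suff : eqmod n.+1 (G.[a] - G.[b]) 0.
  by move=> e k /e; rewrite coefpsB coefps0 => /eqP; rewrite subr_eq0 => /eqP.
have -> : (0 : fps C) = \sum_(i < size G) 0 by rewrite big1.
rewrite !horner_coef -sumrB; apply: eqmod_sum => -[i iG] /=.
rewrite -mulrBr subrXX mulrCA; apply: eqmod0M.
  by move=> k /ab; rewrite coefpsB => ->; rewrite subrr.
case: i iG => [|[|i]] iG.
- by rewrite big_ord0 mulr0.
- by rewrite big_ord1 !expr0 mulr1 mulr1.
- rewrite -/(const_coef _) rmorphM rmorph_sum big1 ?mulr0// => j _.
  rewrite rmorphM !rmorphXn/= /const_coef a0 b0 !expr0n.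
  by case: (nat_of_ord j) => [|j']; rewrite ?mulr0// subn0 mul0r.
Qed.

(* A fixed point of v |-> G.[v] is the t-adic limit of the iterates from 0; by
   submultiplicativity of the weighted norms all iterates stay in one small
   ball, which gives convergence. *)
Lemma convps_fixpoint (G : {poly fps C}) : G \is a polyOver convps ->
  G`_0 0%N = 0 -> G`_1 0%N = 0 ->
  exists u, [/\ u \in convps, u 0%N = 0 & G.[u] = u].
Proof.
move=> cG G0 G1; have [rho r0 [A A0 Ar]] := polyOver_convps_bound cG.
pose w n := iter n (fun v => G.[v]) (0 : fps C).
have const0 v : v 0%N = 0 -> G.[v] 0%N = 0.
  move=> v0; rewrite -/(const_coef _) -horner_map/= (_ : const_coef v = 0)//.
  by rewrite horner_coef0 coef_map.
have w0 n : w n 0%N = 0 by elim: n => //= n; exact: const0.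
have step n : eqmod n (w n) (w n.+1).
  by elim: n => [|n IH]; [by []|exact: (eqmod_horner G1 (w0 _) (w0 _) IH)].
have wN m n : eqmod n (w n) (w (n + m)%N).
  elim: m => [|m IH]; first by rewrite addn0.
  move=> k kn; rewrite IH// addnS step//.
  exact: leq_trans kn (leq_addr _ _).
(* The coefficient of index k is settled from the iterate k + 1 on. *)
pose u : fps C := Fps (fun k => w k.+1 k).
have uw n : eqmod n u (w n).
  move=> k kn /=; rewrite -(subnKC kn).
  by have := @wN (n - k.+1)%N k.+1 k (ltnSn k).
have u0 : u 0%N = 0 by exact: w0.
exists u; split=> //; last first.
  apply: fpsP => n.
  rewrite (@eqmod_horner n.+1 G u (w n.+1))//.
  by rewrite -[LHS]/(w n.+2 n) -uw.
pose D : R := (size G)%:R.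
have D0 : 0 <= D by rewrite ler0n.
(* With weight s ^ 2 * rho the ball of radius s is stable: each of the D terms of [G.[v]] is at most
   A * s ^ 2, by the missing constant term for i = 0, 1 and by v ^ i for i >= 2, and 2 * D * A * s ^
   2 <= s. *)
pose s : R := (2 * D * A + 1)^-1.
have den : 0 < 2 * D * A + 1 by rewrite ltr_wpDl// !mulr_ge0.
have s0 : 0 < s by rewrite invr_gt0.
have s1 : s <= 1 by rewrite invf_le1// lerDr !mulr_ge0.
have sE : 2 * D * A * s ^+ 2 <= s.
  rewrite expr2 mulrA ler_piMl ?(ltW s0)//.
  by rewrite /s ler_pdivrMr// mul1r lerDl.
have t0 : 0 < s ^+ 2 * rho by rewrite mulr_gt0// exprn_gt0.
have s2 : 0 <= s ^+ 2 <= 1 by rewrite exprn_ge0 ?(ltW s0)// expr_le1// ltW.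
have [s20 s21] := andP s2.
have bound v n : wnorm (s ^+ 2 * rho) v n <= s -> wnorm (s ^+ 2 * rho) G.[v] n <= s.
  move=> vs; rewrite horner_coef.
  apply: le_trans (wnorm_sum _ _ _ _ (ltW t0)) _; apply: le_trans sE.
  suff : forall i : 'I_(size G), wnorm (s ^+ 2 * rho) (G`_i * v ^+ i) n <= A * s ^+ 2.
    move=> h; apply: le_trans (ler_sum _ (fun i _ => h i)) _.
    rewrite sumr_const card_ord -[leLHS]mulr_natl -/D.
    rewrite [leRHS](_ : _ = D * (A * s ^+ 2) + D * (A * s ^+ 2)); last by ring.
    by rewrite lerDl; exact: mulr_ge0 D0 (mulr_ge0 A0 s20).
  move=> i; apply: le_trans (wnormM _ _ _ (ltW t0)) _.
  have pw j : wnorm (s ^+ 2 * rho) (v ^+ j) n <= s ^+ j.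
    elim: j => [|j IH].
      rewrite !expr0 /wnorm; case: n {vs} => [|n]; first by rewrite big_ord0.
      rewrite big_ord_recl big1 ?addr0 ?coefps1 ?normc1 ?mulr1// => k _.
      by rewrite coefps1 normc0 mul0r.
    rewrite [v ^+ _]exprS [s ^+ j.+1]exprS; apply: le_trans (wnormM _ _ _ (ltW t0)) _.
    by rewrite ler_pM ?wnorm_ge0// ltW.
  have small a : a 0%N = 0 -> wnorm rho a n <= A -> wnorm (s ^+ 2 * rho) a n <= A * s ^+ 2.
    move=> a0 aA; apply: le_trans (wnormMl _ (ltW r0) s2 a0) _.
    by rewrite mulrC ler_wpM2r.
  case: i => -[|[|i]] iG /=.
  - by rewrite -[leRHS]mulr1 ler_pM ?wnorm_ge0 ?(ltW t0)//; exact: small.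
  - rewrite -[leRHS]mulr1 ler_pM ?wnorm_ge0 ?(ltW t0)//; first exact: small.
    by apply: le_trans s1; rewrite -[leRHS]expr1; exact: pw.
  - rewrite ler_pM ?wnorm_ge0 ?(ltW t0)//.
      apply: le_trans (Ar i.+2 n); apply: wnorm_le; first exact: ltW.
      by rewrite ler_piMl// ltW.
    apply: le_trans (pw _) _; rewrite -addn2 exprD ler_piMl//.
    by rewrite exprn_ile1// ltW.
apply/convpsP; exists (s ^+ 2 * rho) => //; exists s => n.
have -> : wnorm (s ^+ 2 * rho) u n = wnorm (s ^+ 2 * rho) (w n) n.
  by apply: eq_bigr => k _; rewrite (uw n k).
suff : forall m, wnorm (s ^+ 2 * rho) (w m) n <= s by [].
by elim=> [|m IH]; [rewrite wnorm0 ltW|exact: bound].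
Qed.

(** Roots of H are the fixed points of u - H(u) / c, where c is the linear coefficient of H at t =
    0; this choice of c makes the linear coefficient of the map vanish at t = 0. *)
Lemma convps_implicit (H : {poly fps C}) : H \is a polyOver convps ->
  H`_0 0%N = 0 -> H`_1 0%N != 0 ->
  exists u, [/\ u \in convps, u 0%N = 0 & H.[u] = 0].
Proof.
move=> cH H0; set c := H`_1 _ => c0.
pose G := 'X - (Cps c^-1)%:P * H.
have cG : G \is a polyOver convps.
  by rewrite rpredB ?polyOverX// rpredM// polyOverC convps_C.
have [||u [cu u0 Gu]] := convps_fixpoint cG.
- by rewrite coefB coefX coefCM coefpsB coefCpsM H0 mulr0 subrr.
- by rewrite coefB coefX coefCM coefpsB coefCpsM coefps1 mulVf// subrr.
exists u; split=> //; move: Gu; rewrite /G hornerD hornerX hornerN hornerCM => /eqP.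
rewrite -subr_eq0 addrAC subrr add0r oppr_eq0 => /eqP e.
have : Cps c * (Cps c^-1 * H.[u]) = 0 by rewrite e mulr0.
by rewrite mulrA -rmorphM/= -polyCM divff// [fps_of_poly _]rmorph1 mul1r.
Qed.

End Convergent.

(** * Puiseux's theorem *)

Lemma coef_comp_XaddC (A : comNzRingType) (H : {poly A}) (a : A) i :
  (H \Po ('X + a%:P))`_i = H^`N(i).[a].
Proof.
have -> : H \Po ('X + a%:P) = \poly_(j < size H) H^`N(j).[a].
  rewrite /comp_poly addrC nderiv_taylor; last by rewrite /GRing.comm mulrC.
  rewrite size_map_polyC poly_def; apply: eq_bigr => j _.
  by rewrite nderivn_map horner_map/= mul_polyC.
rewrite coef_poly; case: ltnP => // iH; rewrite nderivn_poly0 ?horner0//.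
Qed.

(* If all roots of h coincided, the vanishing subleading coefficient would
   place them at 0, so that h would be a monomial. *)
Lemma root_of_smaller_multiplicity (F : numClosedFieldType) (h : {poly F}) m i :
  size h = m.+1 -> h`_m.-1 = 0 -> (i < m)%N -> h`_i != 0 ->
  exists a n g, [/\ (0 < n < m)%N, h = g * ('X - a%:P) ^+ n & g.[a] != 0].
Proof.
move=> sh h1 im hi.
have m0 : (0 < m)%N by apply: leq_ltn_trans im.
have /closed_rootP[a ra] : size h != 1%N by rewrite sh eqSS -lt0n.
have h0 : h != 0 by rewrite -size_poly_eq0 sh.
have [n [g ga hE]] := multiplicity_XsubC h a.
rewrite h0/= in ga.
exists a, n, g; split=> //.
have n0 : (0 < n)%N.
  case: n hE => // hE; move: ra ga; rewrite {}hE expr0 mulr1 => ->//.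
have g0 : g != 0 by apply: contraNneq ga => ->; rewrite root0.
have sg : (size g + n = m.+1)%N.
  rewrite -sh hE size_Mmonic ?monic_exp ?monicXsubC//.
  by rewrite size_exp_XsubC addnS.
have g1 : (0 < size g)%N by rewrite lt0n size_poly_eq0.
rewrite n0/= ltn_neqAle andbC -ltnS -sg -[n.+1]add1n leq_add2r g1/=.
apply: contraNneq hi => nm; subst n.
have /size_poly1P[c c0 gc] : size g == 1%N by rewrite -(eqn_add2r m) sg.
have : h`_m.-1 = c * (- (a *+ m)).
  rewrite hE gc coefCM; congr (_ * _).
  have := @coefPn_prod_XsubC _ (nseq m a) .
  rewrite size_nseq !big_nseq iter_mulr_1 iter_addr_0 => -> //.
  by rewrite -lt0n.
rewrite h1 => /esym/eqP; rewrite mulf_eq0 (negbTE c0) oppr_eq0 mulrn_eq0.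
rewrite gtn_eqF//= => /eqP a0.
by rewrite hE gc a0 subr0 coefCM coefXn ltn_eqF// mulr0.
Qed.

Section Puiseux.
Variable R : realType.
Local Notation C := R[i].

Lemma map_dilate_comp p q (H : {poly fps C}) :
  map_poly (dilate p) (map_poly (dilate q) H) =
  map_poly (dilate (p.+1 * q.+1).-1) H.
Proof.
by apply/polyP => i; rewrite !coef_map/= dilate_comp.
Qed.

(* Tschirnhausen: the coefficient of index m - 1 can be cancelled by a
   convergent shift, so that the leading form of the first Newton polygon edge
   is not a pure m-th power and the multiplicity m decreases. *)
Lemma puiseux_local m (H : {poly fps C}) : (0 < m)%N ->
  H \is a polyOver (@convps R) ->
  (forall i, (i < m)%N -> H`_i 0%N = 0) -> H`_m 0%N != 0 ->
  exists q u, [/\ u \in @convps R, u 0%N = 0 & (map_poly (dilate q) H).[u] = 0].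
Proof.
elim/ltn_ind: m H => m IH H m0 cH H0 Hm.
(* The linear coefficient of this derivative is m H_m, which is nonzero at t = 0. *)
have [||| alpha [calpha alpha0 Halpha]] := @convps_implicit R H^`N(m.-1).
- exact: polyOver_nderivn.
- by rewrite coef_nderivn addn0 binn mulr1n H0// ltn_predL.
- rewrite coef_nderivn addn1 prednK// -[m in 'C(m, _)]prednK// binSn prednK//.
  by rewrite -/(const_coef _) rmorphMn mulrn_eq0 (gtn_eqF m0).
pose K := H \Po ('X + alpha%:P).
have cK : K \is a polyOver (@convps R).
  by rewrite polyOver_comp// rpredD ?polyOverX// polyOverC.
have K0 i : K`_i 0%N = H`_i 0%N.
  rewrite -/(const_coef _) -coef_map map_comp_poly rmorphD/= map_polyX map_polyC/=.
  by rewrite [const_coef alpha]alpha0 addr0 comp_polyXr coef_map.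
(* If the shifted polynomial has no constant term, alpha is already a root. *)
have [K00|K00] := eqVneq K`_0 0.
  exists 0%N, alpha; split=> //; transitivity K`_0 => //.
  rewrite coef_comp_XaddC nderivn0; congr (_.[_]).
  by apply/polyP => i; rewrite coef_map/= dilate0.
have [k0 Kk0] : exists k, K`_0 k != 0.
  apply: contrapT => nk; case/eqP: K00; apply: fpsP => k; apply/eqP.
  by apply: contrapT => /negP ck; apply: nk; exists k.
(* After t -> t ^ (m!) all exponents are multiples of m!, hence of each m - i, so the slope of the
   first Newton edge is an integer. *)
pose M := m`!.
have M0 : (0 < M)%N by rewrite fact_gt0.
pose c i := dilate M.-1 K`_i.
have cE i k : c i (k * M)%N = K`_i k by rewrite -[X in (_ * X)%N](prednK M0) coef_dilate_mul.
have cdvd i k : c i k != 0 -> (M %| k)%N.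
  by rewrite /c/= prednK//; case: ifP => //; rewrite eqxx.
(* [Q p]: t ^ (p (m - i)) divides c_i for i < m, that is, the Newton polygon lies on or above the
   line of slope -p through (m, 0). The largest p gives the first edge. *)
pose Q p := `[< forall i k, (i < m)%N -> (k < p * (m - i))%N -> c i k = 0 >].
have Qbound p : Q p -> (p <= k0 * M)%N.
  move=> /asboolP Qp; rewrite leqNgt; apply/negP => kp.
  move: Kk0; rewrite -cE Qp ?eqxx// subn0.
  by apply: leq_trans kp _; rewrite leq_pmulr.
have Q1 : Q 1%N.
  apply/asboolP => i k im; rewrite mul1n => kmi.
  apply/eqP/negPn/negP => ck; have /dvdnP[[|j] kE] := cdvd _ _ ck.
    by move: ck; rewrite kE cE K0 H0// eqxx.
  move: kmi; rewrite kE ltnNge => /negP; apply.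
  rewrite mulSn; apply: leq_trans (leq_addr _ _).
  by apply: leq_trans (leq_subr _ _) _; exact: fact_geq.
have [p /asboolP Qp pmax] := ex_maxnP (ex_intro (fun p => Q p) _ Q1) Qbound.
have p0 : (0 < p)%N by exact: pmax.
(* Maximality forces a point on the line: exponents in c_i are multiples of m - i, so a point
   strictly above the line satisfies the bound for p + 1. *)
have [i0 [i0m ci0]] : exists i, (i < m)%N /\ c i (p * (m - i))%N != 0.
  apply: contrapT => nex.
  suff /pmax : Q p.+1 by rewrite ltnn.
  apply/asboolP => i k im kp; apply/eqP/negPn/negP => ck.
  have mi0 : (0 < m - i)%N by rewrite subn_gt0.
  have /dvdnP[j kE] : (m - i %| k)%N.
    by apply: dvdn_trans (cdvd _ _ ck); rewrite dvdn_fact// mi0 leq_subr.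
  move: kp; rewrite kE ltn_pmul2r// ltnS leq_eqVlt => /orP[/eqP jp|jp].
    by apply: nex; exists i; split=> //; rewrite -jp -kE.
  by move: ck; rewrite kE Qp ?eqxx// ltn_pmul2r.
(* The coefficients of t ^ (- p m) K(t ^ p v); for i >= m the power of t is nonnegative. *)
pose e i := if (i < m)%N then shiftps (p * (m - i)) (c i)
            else Xps C (p * (i - m)) * c i.
have cc i : c i \in @convps R by rewrite convps_dilate// (polyOverP cK).
have ce i : e i \in @convps R.
  by rewrite /e; case: ifP => _; rewrite ?convps_shift// rpredM ?convps_X.
have eE i : Xps C (p * m) * e i = Xps C (p * i) * c i.
  rewrite /e; case: ltnP => im; last by rewrite mulrA -XpsD -mulnDr subnKC.
  have -> : Xps C (p * m) = Xps C (p * i) * Xps C (p * (m - i)).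
    by rewrite -XpsD -mulnDr subnKC// ltnW.
  rewrite -mulrA shiftpsK// => k; exact: Qp.
pose G := \poly_(i < size K) e i.
have Ge i : G`_i = e i.
  rewrite coef_poly; case: ltnP => // iK.
  rewrite /e /c nth_default// raddf0 mulr0.
  by case: ifP => // _; apply: fpsP.
have GK q v : Xps C (p * m * q.+1) * (map_poly (dilate q) G).[v] =
    (map_poly (dilate q) (map_poly (dilate M.-1) K)).[Xps C (p * q.+1) * v].
  rewrite (@horner_coef_wide _ (size K)); last first.
    by rewrite (leq_trans (size_poly _ _))// size_poly.
  rewrite (@horner_coef_wide _ (size K)); last first.
    by rewrite (leq_trans (size_poly _ _))// size_poly.
  rewrite mulr_sumr; apply: eq_bigr => i _.
  rewrite !coef_map/= Ge mulrA -dilate_Xps -rmorphM/= eE rmorphM/= -/(c i).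
  rewrite exprMn XpsX dilate_Xps mulnAC mulrA; congr (_ * _).
  by rewrite mulrC -mulnA mulnC -mulnA [(i * _)%N]mulnC mulnA.
(* The edge polynomial, G at t = 0: it has degree m, no term of index m - 1 by the choice of alpha,
   and a nonzero coefficient of index i0 < m. *)
pose h := map_poly (@const_coef C) G.
have hE i : h`_i = e i 0%N by rewrite coef_map/= Ge.
have hm : h`_m != 0.
  have cm0 : c m 0%N = K`_m 0%N := cE m 0%N.
  by rewrite hE /e ltnn subnn muln0 coefXpsM ltnn cm0 K0.
have hbig i : (m < i)%N -> h`_i = 0.
  by move=> mi; rewrite hE /e ltnNge (ltnW mi) coefXpsM muln_gt0 p0 subn_gt0 mi.
have sh : size h = m.+1.
  apply/eqP; rewrite eqn_leq; apply/andP; split; first exact/leq_sizeP.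
  by rewrite ltnNge; apply: contra hm => /leq_sizeP ->.
have h1 : h`_m.-1 = 0.
  have c1 : c m.-1 = 0 by rewrite /c coef_comp_XaddC Halpha raddf0.
  by rewrite hE /e ltn_predL m0 c1.
have hi0 : h`_i0 != 0 by rewrite hE /e i0m.
have [a [n [g [/andP[n0 nm] hg ga]]]] := root_of_smaller_multiplicity sh h1 i0m hi0.
(* Recentring at the root a, of multiplicity n < m, prepares the induction hypothesis. *)
pose S := 'X + (Cps a)%:P : {poly fps C}.
have hS : map_poly (@const_coef C) (G \Po S) = (g \Po ('X + a%:P)) * 'X^n.
  rewrite map_comp_poly -/h hg rmorphD/= map_polyX map_polyC/=.
  rewrite coefC/= comp_polyM; congr (_ * _).
  by rewrite rmorphXn/= comp_polyB comp_polyX comp_polyC addrK.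
have GS i : (G \Po S)`_i 0%N = ((g \Po ('X + a%:P)) * 'X^n)`_i by rewrite -hS coef_map.
have [||||q [u [cu u0 Gu]]] := IH n nm (G \Po S) => //.
- rewrite polyOver_comp// ?rpredD ?polyOverX ?polyOverC ?convps_C//.
  by apply/polyOverP => i; rewrite Ge.
- by move=> i lt_in; rewrite GS coefMXn lt_in.
- by rewrite GS coefMXn ltnn subnn -horner_coef0 horner_comp !hornerE.
(* The scaling and then the shift by alpha are undone; the dilations by q + 1 and by m! compose. *)
pose v := Xps C (p * q.+1) * (u + Cps a).
exists (q.+1 * M.-1.+1).-1, (v + dilate (q.+1 * M.-1.+1).-1 alpha); split.
- by rewrite rpredD ?convps_dilate// rpredM ?convps_X// rpredD ?convps_C.
- rewrite coefpsD coefXpsM muln_gt0 p0 add0r.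
  by rewrite -[LHS]/(const_coef _) const_dilate.
- transitivity ((map_poly (dilate (q.+1 * M.-1.+1).-1) K).[v]).
    rewrite /K map_comp_poly rmorphD/= map_polyX map_polyC/= horner_comp.
    by rewrite hornerD hornerX hornerC.
  rewrite -map_dilate_comp -GK.
  have : (map_poly (dilate q) (G \Po S)).[u] = 0 by [].
  rewrite map_comp_poly rmorphD/= map_polyX map_polyC/= dilate_Cps.
  by rewrite horner_comp hornerD hornerX hornerC => ->; rewrite mulr0.
Qed.

End Puiseux.

(** * Sums of convergent power series *)

Section Evaluation.
Local Open Scope classical_set_scope.
Local Open Scope complex_scope.
Variable R : realType.
Local Notation C := R[i].
Implicit Types (a b : fps C) (s z : C) (rho A : R).

Lemma normrcE z : `|z| = (normc z)%:C.
Proof. by rewrite normc_def; case: z. Qed.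

Lemma cvgcP (T : Type) (F : set_system T) (FF : Filter F) (u : T -> C) (l : C) :
  u x @[x --> F] --> l <->
  forall e : R, 0 < e -> \forall x \near F, normc (l - u x) < e.
Proof.
split=> [/cvgrPdist_lt ul e e0|ul].
  have := ul e%:C; rewrite ltcR => /(_ e0); apply: filterS => x.
  by rewrite normrcE ltcR.
apply/cvgrPdist_lt => -[e e']; rewrite ltcE/= => /andP[/eqP -> e0].
by apply: filterS (ul e e0) => x ux; rewrite normrcE -[e +i* 0]/e%:C ltcR.
Qed.

Lemma cvgc0P (T : Type) (F : set_system T) (FF : Filter F) (u : T -> C) :
  u x @[x --> F] --> (0 : C) <-> normc (u x) @[x --> F] --> (0 : R).
Proof.
split=> [/cvgcP ul|/cvgrPdist_lt ul].
  apply/cvgrPdist_lt => e /ul; apply: filterS => x.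
  by rewrite !sub0r normrN normcN ger0_norm// normc_ge0.
apply/cvgcP => e /ul; apply: filterS => x.
by rewrite !sub0r normrN normcN ger0_norm// normc_ge0.
Qed.

Lemma cvgc_unique (u : nat -> C) (l l' : C) :
  u n @[n --> \oo] --> l -> u n @[n --> \oo] --> l' -> l = l'.
Proof. by move=> h h'; exact: (cvg_unique (@norm_hausdorff _ C) h h'). Qed.

Lemma cvgc_le (u : nat -> C) (l : C) A :
  u n @[n --> \oo] --> l -> (forall n, normc (u n) <= A) -> normc l <= A.
Proof.
move=> /cvgcP ul uA; apply/ler_addgt0Pr => e /ul[N _ /(_ N (leqnn N)) lu].
rewrite -(subrK (u N) l) (le_trans (le_normcD _ _))//.
by rewrite [leRHS]addrC lerD// ltW.
Qed.

Lemma cvgc_pair (x y : nat -> R) : cvgn x -> cvgn y ->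
  exists l : C, (x n +i* y n) @[n --> \oo] --> l.
Proof.
move=> cx cy; exists (lim (x @ \oo) +i* lim (y @ \oo)).
have h := @complex_continuous R (lim (x @ \oo), lim (y @ \oo)).
exact: (cvg_comp _ _ (cvg_pair cx cy) h).
Qed.

Definition psum a s n := \sum_(k < n) a k * s ^+ k.

Lemma psumD a b s n : psum (a + b) s n = psum a s n + psum b s n.
Proof. by rewrite -big_split/=; apply: eq_bigr => k _; rewrite -mulrDl. Qed.

Lemma psum_poly (p : {poly C}) s n : (size p <= n)%N ->
  psum (fps_of_poly p) s n = p.[s].
Proof. by move=> pn; rewrite (horner_coef_wide _ pn). Qed.

Lemma psum_dilate q a s n : psum (dilate q a) s (n * q.+1) = psum a (s ^+ q.+1) n.
Proof.
elim: n => [|n IH]; first by rewrite /psum mul0n !big_ord0.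
rewrite /psum [RHS]big_ord_recr/= -[X in _ = X + _]IH mulSn addnC.
rewrite big_split_ord/= big_ord_recl /= addn0 dvdn_mull// mulnK// -exprM mulnC.
rewrite [X in _ + (_ + X)]big1 ?addr0// => i _.
rewrite /bump/= dvdn_addr ?dvdn_mulr// gtnNdvd ?mul0r//.
by rewrite add1n ltnS.
Qed.

(** Each term is at most (|s| / rho) ^ k times its weighted norm, and only k >= n contribute. *)
Lemma psum_tail rho A a s n N : 0 < rho -> normc s <= rho ->
  (forall k, wnorm rho a k <= A) -> (forall k, (k < n)%N -> a k = 0) ->
  normc (psum a s N) <= (normc s / rho) ^+ n * A.
Proof.
move=> r0 sr aA a0; apply: le_trans (normc_sum _ _ _) _.
have t0 : 0 <= normc s / rho by rewrite divr_ge0 ?normc_ge0// ltW.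
have t1 : normc s / rho <= 1 by rewrite ler_pdivrMr// mul1r.
apply: (@le_trans _ _ ((normc s / rho) ^+ n * wnorm rho a N)); last first.
  by rewrite ler_wpM2l ?exprn_ge0.
rewrite mulr_sumr; apply: ler_sum => k _; rewrite normcM normcX.
have [kn|nk] := ltnP k n; first by rewrite a0// normc0 !mul0r mulr0.
rewrite mulrCA ler_wpM2l ?normc_ge0//.
have -> : normc s ^+ k = (normc s / rho) ^+ k * rho ^+ k.
  by rewrite -exprMn divfK// gt_eqF.
by rewrite ler_wpM2r ?exprn_ge0 ?(ltW r0)// ler_wiXn2l.
Qed.

Definition partial_poly a n : {poly C} := \poly_(k < n) a k.

Lemma horner_partial_poly a s n : (partial_poly a n).[s] = psum a s n.
Proof.
rewrite (@horner_coef_wide _ n) ?size_poly//.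
by apply: eq_bigr => k _; rewrite coef_poly ltn_ord.
Qed.

Lemma wnorm_partial_poly rho A a n k : 0 <= rho -> (forall k, wnorm rho a k <= A) ->
  wnorm rho (fps_of_poly (partial_poly a n)) k <= A.
Proof.
move=> r0 aA; apply: le_trans (aA k); apply: ler_sum => i _ /=.
rewrite coef_poly; case: ifP => // _.
by rewrite normc0 mul0r mulr_ge0 ?normc_ge0 ?exprn_ge0.
Qed.

(** The norm bound accompanies the limit because convergence at a point alone is not preserved by
    Cauchy products. *)
Definition evaluates rho a s (v : C) :=
  (exists A, forall k, wnorm rho a k <= A) /\ psum a s n @[n --> \oo] --> v.

Section Point.
Variables (rho : R) (s : C).
Hypotheses (rho0 : 0 < rho) (srho : normc s < rho).

Lemma psum_cvg A a : (forall k, wnorm rho a k <= A) ->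
  exists v : C, psum a s n @[n --> \oo] --> v.
Proof.
move=> aA.
have abs (x : nat -> R) : (forall k, `|x k| <= normc (a k) * rho ^+ k) ->
    cvgn (series x).
  move=> xa; apply: normed_cvg; apply: nondecreasing_is_cvgn.
    by apply: (@nondecreasing_series _ (fun k => `|x k|) xpredT 0) => n _ _.
  exists A => _ [n _ <-]; apply: le_trans (aA n).
  by rewrite /= seriesEord/=; apply: ler_sum => k _.
have bnd k : normc (a k * s ^+ k) <= normc (a k) * rho ^+ k.
  rewrite normcM normcX ler_wpM2l ?normc_ge0// lerXn2r ?nnegrE ?normc_ge0//.
    exact: ltW.
  exact: ltW.
have c1 := abs (fun k => complex.Re (a k * s ^+ k))
  (fun k => le_trans (normc_ge_comp _).1 (bnd k)).
have c2 := abs (fun k => complex.Im (a k * s ^+ k))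
  (fun k => le_trans (normc_ge_comp _).2 (bnd k)).
have [l cl] := cvgc_pair c1 c2; exists l.
rewrite (_ : psum a s = fun n => (series (fun k => complex.Re (a k * s ^+ k)) n
  +i* series (fun k => complex.Im (a k * s ^+ k)) n))//.
apply/funext => n; rewrite !seriesEord/= /psum.
elim/big_rec3 : _ => [//|k x y z _ ->].
by case: (_ * _).
Qed.

Lemma evaluates_exists A a : (forall k, wnorm rho a k <= A) ->
  exists v, evaluates rho a s v.
Proof. by move=> aA; have [v av] := psum_cvg aA; exists v; split=> //; exists A. Qed.

Lemma evaluates_unique a v v' : evaluates rho a s v -> evaluates rho a s v' -> v = v'.
Proof. by move=> [_ h] [_ h']; exact: cvgc_unique h h'. Qed.

Lemma evaluates_poly (p : {poly C}) : evaluates rho (fps_of_poly p) s p.[s].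
Proof.
split.
  exists (\sum_(k < size p) normc p`_k * rho ^+ k) => n.
  have h0 k : 0 <= normc p`_k * rho ^+ k by rewrite mulr_ge0 ?normc_ge0 ?exprn_ge0// ltW.
  apply: (@le_trans _ _ (\sum_(k < maxn n (size p)) normc p`_k * rho ^+ k)).
    rewrite /wnorm (big_ord_widen (maxn n (size p)) (fun k => normc p`_k * rho ^+ k)) ?leq_maxl//.
    by rewrite [leRHS](bigID (fun k : 'I__ => (k < n)%N))/= lerDl sumr_ge0.
  rewrite [leRHS](big_ord_widen (maxn n (size p)) (fun k => normc p`_k * rho ^+ k)) ?leq_maxr//.
  rewrite (bigID (fun k : 'I__ => (k < size p)%N))/= [X in _ + X]big1 ?addr0// => k.
  by rewrite -leqNgt => /(nth_default 0) ->; rewrite normc0 mul0r.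
apply: cvg_near_cst; exists (size p) => // n /= pn.
exact: psum_poly.
Qed.

Lemma evaluatesD a b v v' : evaluates rho a s v -> evaluates rho b s v' ->
  evaluates rho (a + b) s (v + v').
Proof.
move=> [[A aA] av] [[B bB] bv]; split.
  exists (A + B) => k; apply: le_trans (wnormD _ _ _ (ltW rho0)) _.
  by rewrite lerD.
rewrite (_ : psum (a + b) s = fun n => psum a s n + psum b s n).
  exact: (cvgD av bv).
by apply/funext => n; rewrite psumD.
Qed.

Lemma evaluatesM a b v v' : evaluates rho a s v -> evaluates rho b s v' ->
  evaluates rho (a * b) s (v * v').
Proof.
move=> [[A aA] av] [[B bB] bv].
have abAB k : wnorm rho (a * b) k <= A * B.
  apply: le_trans (wnormM _ _ _ (ltW rho0)) _.
  by rewrite ler_pM ?wnorm_ge0// ltW.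
split; first by exists (A * B).
have theta : `|normc s / rho| < 1.
  by rewrite ger0_norm ?divr_ge0 ?normc_ge0 ?(ltW rho0)// ltr_pdivrMr// mul1r.
(* [d n] is the value of a polynomial without terms of degree below n and of norm at most 2 A B, so
   it tends to 0 geometrically. *)
pose d n := (partial_poly a n * partial_poly b n).[s] - (partial_poly (a * b) n).[s].
have dbound n : normc (d n) <= (normc s / rho) ^+ n * (A * B + A * B).
  pose p := partial_poly a n * partial_poly b n - partial_poly (a * b) n.
  have -> : d n = psum (fps_of_poly p) s (size p) by rewrite psum_poly// /p hornerD hornerN.
  apply: psum_tail => //; first exact: ltW.
    move=> k; rewrite rmorphB rmorphM/=.
    apply: le_trans (wnormD _ _ _ (ltW rho0)) _; rewrite wnormN lerD//; last first.
      exact: wnorm_partial_poly (ltW rho0) _.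
    apply: le_trans (wnormM _ _ _ (ltW rho0)) _.
    by rewrite ler_pM ?wnorm_ge0 ?(ltW rho0)//; apply: wnorm_partial_poly => //; exact: ltW.
  move=> k kn; rewrite rmorphB rmorphM coefpsB [X in _ - X]/= coef_poly kn.
  apply/eqP; rewrite subr_eq0; apply/eqP; apply: (@eqmodM _ n) => // i lt_in /=;
    by rewrite coef_poly lt_in.
have d0 : d n @[n --> \oo] --> (0 : C).
  apply/cvgc0P; apply: (@squeeze_cvgr _ _ _ _ (fun=> 0)
    (fun n => (normc s / rho) ^+ n * (A * B + A * B))).
  - by apply: nearW => n; rewrite normc_ge0 dbound.
  - exact: cvg_cst.
  - by rewrite -[X in _ --> X](mul0r (A * B + A * B)); apply: cvgMr_tmp; exact: cvg_expr.
rewrite (_ : psum (a * b) s = fun n => psum a s n * psum b s n - d n).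
  by rewrite -[v * v']subr0; exact: (cvgB (cvgM av bv) d0).
by apply/funext => n; rewrite /d hornerM !horner_partial_poly subKr.
Qed.

Lemma evaluatesX a v n : evaluates rho a s v -> evaluates rho (a ^+ n) s (v ^+ n).
Proof.
move=> av; elim: n => [|n IH]; last by rewrite !exprS; exact: evaluatesM.
by have := evaluates_poly 1; rewrite rmorph1 hornerC !expr0.
Qed.

Lemma evaluates_sum I (r : seq I) (P : pred I) (F : I -> fps C) (G : I -> C) :
  (forall i, evaluates rho (F i) s (G i)) ->
  evaluates rho (\sum_(i <- r | P i) F i) s (\sum_(i <- r | P i) G i).
Proof.
move=> FG; apply: (big_rec2 (fun a v => evaluates rho a s v)) => [|i a v _ av].
  by have := evaluates_poly 0; rewrite rmorph0 hornerC.
exact: (evaluatesD (FG i) av).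
Qed.

Lemma evaluates_homogenization (S : nzRingType) (f : {poly {poly S}})
    (phi : {rmorphism S -> fps C}) (psi : {rmorphism S -> C}) a b c x y z :
  (forall r, evaluates rho (phi r) s (psi r)) ->
  evaluates rho a s x -> evaluates rho b s y -> evaluates rho c s z ->
  evaluates rho (homogenization f phi a b c) s (homogenization f psi x y z).
Proof.
move=> h ax bY cz; apply: evaluates_sum => j; apply: evaluates_sum => i.
exact: (evaluatesM (evaluatesM (evaluatesM (h _) (evaluatesX _ ax))
  (evaluatesX _ bY)) (evaluatesX _ cz)).
Qed.

Lemma evaluates_le A a v n : evaluates rho a s v -> (forall k, wnorm rho a k <= A) ->
  (forall k, (k < n)%N -> a k = 0) -> normc v <= (normc s / rho) ^+ n * A.
Proof.
move=> [_ av] aA a0; apply: cvgc_le av _ => N.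
by apply: psum_tail => //; exact: ltW.
Qed.

End Point.

End Evaluation.

(** * Auxiliary facts on polynomials *)

Lemma infinite_roots (F : numFieldType) (p : {poly F}) :
  (forall x, x != 0 -> p.[x] = 0) -> p = 0.
Proof.
move=> px; apply/eqP/negPn/negP => p0.
suff : (size [seq n.+1%:R : F | n <- iota 0 (size p)] < size p)%N.
  by rewrite size_map size_iota ltnn.
apply: max_poly_roots => //.
  by apply/allP => _ /mapP[n _ ->]; apply/eqP/px; rewrite pnatr_eq0.
rewrite map_inj_uniq ?iota_uniq// => m n /eqP.
by rewrite eqr_nat eqSS => /eqP.
Qed.

(** The inner variable is t. The power of t dividing all coefficients is bounded through the leading
    coefficient, so a largest one exists; if the quotient vanished at t = 0, one more factor could
    be split off. *)
Lemma poly2_primitive_part (F : fieldType) (P : {poly {poly F}}) : P != 0 ->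
  exists e P0, P = ('X^e)%:P * P0 /\ map_poly (horner_eval 0) P0 != 0.
Proof.
move=> P0; pose Q e := `[< forall i, 'X^e %| P`_i >].
have Q0 : exists e, Q e by exists 0%N; apply/asboolP => i; exact: dvd1p.
have Qle e : Q e -> (e <= size (lead_coef P))%N.
  move=> /asboolP/(_ (size P).-1); rewrite -lead_coefE => /dvdp_leq.
  by rewrite size_polyXn lead_coef_eq0 => /(_ P0)/ltnW.
have [e /asboolP Qe emax] := ex_maxnP Q0 Qle.
pose P1 := \poly_(i < size P) (P`_i %/ 'X^e).
have P1E i : P1`_i = P`_i %/ 'X^e.
  by rewrite coef_poly; case: ltnP => // iP; rewrite nth_default// div0p.
exists e, P1; split.
  by apply/polyP => i; rewrite coefCM P1E mulrC divpK.
apply/negP => /eqP P10; suff /emax : Q e.+1 by rewrite ltnn.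
apply/asboolP => i; rewrite -(divpK (Qe i)) exprS dvdp_mul2r ?monic_neq0 ?monicXn//.
have := congr1 (fun p : {poly F} => p`_i) P10.
rewrite coef_map/= coef0 P1E /horner_eval => /eqP.
by rewrite -/(root _ _) -dvdp_XsubCl subr0.
Qed.

Section HomogenizationHorner.
Variables (R : nzRingType) (f : {poly {poly R}}).

Lemma homogenization_horner (K : comNzRingType) (phi : {rmorphism R -> K})
    (x y z : {poly K}) t :
  (homogenization f (polyC \o phi) x y z).[t] =
  homogenization f phi x.[t] y.[t] z.[t].
Proof.
rewrite -[LHS]/(horner_eval t _) homogenization_rmorph.
by apply: homogenization_eqphi => r /=; rewrite /horner_eval hornerC.
Qed.

End HomogenizationHorner.

(** * Points near infinity and N-th roots near 1 *)

Section Roots.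
Local Open Scope complex_scope.
Variable R : realType.
Local Notation C := R[i].

Lemma curveE (f : {poly {poly R}}) (z y : C) :
  curve f (z, y) <-> homogenization f (real_complex R) z y 1 = 0.
Proof.
rewrite /curve/=.
suff -> : (map_poly (map_poly (real_complex R)) f).[y%:P].[z] =
    homogenization f (real_complex R) z y 1 by [].
rewrite (horner_coef_wide _ (size_poly _ _)) horner_sum.
apply: eq_bigr => j _; rewrite -polyC_exp hornerM hornerC coef_map/=.
rewrite (horner_coef_wide _ (size_poly _ _)) mulr_suml.
by apply: eq_bigr => i _; rewrite coef_map/= expr1n mulr1.
Qed.

(** (1 : y : 1/z) and (z : z y : 1) are the same projective point. *)
Lemma homogenization_y (f : {poly {poly R}}) (y z : C) : z != 0 ->
  homogenization f (real_complex R) 1 y z^-1 = 0 <-> curve f (z, z * y).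
Proof.
move=> z0; rewrite curveE.
have -> : homogenization f (real_complex R) z (z * y) 1 =
    z ^+ total_degree f * homogenization f (real_complex R) 1 y z^-1.
  by rewrite -homogenizationZ mulr1 divff.
split=> [->|/eqP]; first by rewrite mulr0.
by rewrite mulf_eq0 expf_eq0 (negbTE z0) andbF/= => /eqP.
Qed.

Lemma CexpD (x y : C) : Cexp (x + y) = Cexp x * Cexp y.
Proof.
case: x y => [a b] [c d]; rewrite /Cexp/= expRD cosD sinD; simpc.
by congr (_ +i* _); ring.
Qed.

Lemma CexpMn (x : C) n : Cexp (x *+ n) = Cexp x ^+ n.
Proof.
elim: n => [|n IH]; last by rewrite mulrS exprS CexpD IH.
by rewrite mulr0n expr0 /Cexp/= expR0 cos0 sin0; simpc.
Qed.

(** Both roots are exponentials of multiples of the same logarithm, so the fixed determination stays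
    coherent when the ramification index changes. *)
Lemma principal_rootX N q (z : C) : (0 < q)%N ->
  principal_root (N * q) z ^+ q = principal_root N z.
Proof.
move=> q0; rewrite /principal_root -CexpMn; congr Cexp.
have q0' : q%:R != 0 :> C by rewrite pnatr_eq0 -lt0n.
by rewrite -[LHS]mulr_natr natrM invfM mulrA divfK.
Qed.

Lemma principal_rootK N (z : C) : (0 < N)%N -> z != 0 ->
  principal_root N z ^+ N = z.
Proof.
move=> N0 z0; have := @principal_rootX 1 N z N0.
by rewrite mul1n => ->; rewrite /principal_root divr1 CexpK.
Qed.

Lemma normc_gt0 (z : C) : (0 < normc z) = (z != 0).
Proof.
rewrite lt_neqAle normc_ge0 andbT eq_sym; congr (~~ _).
by apply/eqP/eqP => [/eq0_normc|->]; rewrite ?normc0.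
Qed.

Lemma normc_root_lt N (s z : C) rho : (0 < N)%N -> 0 < rho -> s ^+ N = z^-1 ->
  rho ^- N < normc z -> normc s < rho.
Proof.
move=> N0 r0 sz rz; rewrite -(@ltr_pXn2r _ N)// ?nnegrE ?normc_ge0 ?(ltW r0)//.
rewrite -normcX sz normcV -(invrK (rho ^+ N)) ltf_pV2 ?posrE//.
  by rewrite (lt_trans _ rz)// invr_gt0 exprn_gt0.
by rewrite invr_gt0 exprn_gt0.
Qed.

Lemma exists_root N (a : C) : (0 < N)%N -> exists x, x ^+ N = a.
Proof.
move=> N0; have /closed_rootP[x] : size ('X^N - a%:P) != 1%N.
  by rewrite size_XnsubC// eqSS -lt0n.
by rewrite rootE !hornerE subr_eq0 => /eqP; exists x.
Qed.

(** 1 - a is the product of 1 - t over the N roots t of X ^ N = a; if all factors had modulus at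
    least delta, it would have modulus at least delta ^ N. *)
Lemma root_near_one_lt N (a : C) delta : (0 < N)%N -> 0 < delta ->
  normc (1 - a) < delta ^+ N -> exists2 t, t ^+ N = a & normc (1 - t) < delta.
Proof.
move=> N0 d0 ad; pose p : {poly C} := 'X^N - a%:P.
have [r pE] := closed_field_poly_normal p.
have lp : lead_coef p = 1 by rewrite lead_coefXnsubC.
rewrite lp scale1r in pE.
have sr : size r = N.
  by have := congr1 (size \o polyseq) pE; rewrite /= size_XnsubC// size_prod_XsubC => -[].
have [/hasP[t tr td]|] := boolP (has (fun t => normc (1 - t) < delta) r).
  exists t => //; have : root p t by rewrite pE root_prod_XsubC.
  by rewrite rootE !hornerE subr_eq0 => /eqP.
rewrite -all_predC => /allP far; move: ad; rewrite ltNge => /negP[].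
have -> : 1 - a = \prod_(t <- r) (1 - t).
  have := congr1 (horner^~ 1) pE; rewrite !hornerE expr1n => ->.
  by rewrite horner_prod; apply: eq_bigr => t _; rewrite !hornerE.
rewrite -sr; elim: r far {pE sr} => [|t r IH] far.
  by rewrite big_nil expr0 normc1.
rewrite big_cons exprS normcM ler_pM ?exprn_ge0 ?(ltW d0)//.
  by rewrite leNgt; apply: far; rewrite mem_head.
by apply: IH => u ur; apply: far; rewrite inE ur orbT.
Qed.

Lemma pow_near_one N (t : C) k : (k <= N)%N -> normc t <= 2 ->
  normc (1 - t ^+ k) <= (N%:R * 2 ^+ N) * normc (1 - t).
Proof.
move=> kN t2; rewrite -{1}(expr1n _ k) subrXX normcM mulrC.
rewrite ler_wpM2r ?normc_ge0//; apply: le_trans (normc_sum _ _ _) _.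
apply: (@le_trans _ _ (\sum_(i < k) 2 ^+ N)).
  apply: ler_sum => i _; rewrite expr1n mul1r normcX.
  apply: (@le_trans _ _ (2 ^+ i)); first by rewrite lerXn2r ?nnegrE ?normc_ge0.
  by rewrite ler_weXn2l ?ler1n// (leq_trans _ kN)// ltnW.
rewrite sumr_const card_ord -[leLHS]mulr_natl ler_wpM2r ?exprn_ge0//.
by rewrite ler_nat.
Qed.

(* The root of X ^ N = a nearest to 1 depends on a in a Lipschitz way, since
   1 - a = (1 - t) (1 + t + ... + t ^ (N - 1)), where the second factor is
   close to N. *)
Lemma root_near_one N : (0 < N)%N -> exists K eta : R, [/\ 0 < K, 0 < eta &
  forall a : C, normc (1 - a) < eta -> exists2 t, t ^+ N = a &
    normc t <= 2 /\
    forall k, (k <= N)%N -> normc (t ^+ N - t ^+ k) <= K * normc (1 - a)].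
Proof.
move=> N0; pose K : R := N%:R * 2 ^+ N.
have K1 : 1 <= K by rewrite /K -natrX -natrM ler1n muln_gt0 N0 expn_gt0.
have K0 : 0 < K by lra.
(* For |1 - t| < delta every 1 - t ^ j with j < N has modulus at most 1/2, so the sum of the t ^ j
   has modulus at least N / 2. *)
pose delta : R := (2 * K)^-1.
have d0 : 0 < delta by rewrite invr_gt0 mulr_gt0.
have dK : K * delta = 2^-1 by rewrite /delta invfM mulrCA divff ?mulr1// gt_eqF.
exists (2 ^+ N * K * 2), (delta ^+ N); split; rewrite ?exprn_gt0//.
  by rewrite mulr_gt0// (mulr_gt0 _ K0)// exprn_gt0.
move=> a /(root_near_one_lt N0 d0)[t ta td]; exists t => //.
have d1 : delta <= 1 by have := ler_wpM2r (ltW d0) K1; lra.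
have t2 : normc t <= 2.
  have := le_normcD 1 (t - 1); rewrite addrC subrK normc1 -[t - 1]opprB normcN.
  lra.
split=> // k kN.
have lin : normc (1 - t) <= 2 * normc (1 - a).
  have -> : 1 - a = (1 - t) * \sum_(j < N) t ^+ j.
    rewrite -ta -{1}(expr1n _ N) subrXX; congr (_ * _); apply: eq_bigr => j _.
    by rewrite expr1n mul1r.
  suff h : 2^-1 <= normc (\sum_(j < N) t ^+ j).
    rewrite normcM mulrCA ler_peMr ?normc_ge0//; lra.
  have h1 : normc (N%:R - \sum_(j < N) t ^+ j) <= N%:R / 2.
    have -> : N%:R - \sum_(j < N) t ^+ j = \sum_(j < N) (1 - t ^+ j).
      by rewrite sumrB sumr_const card_ord.
    apply: le_trans (normc_sum _ _ _) _.
    apply: (@le_trans _ _ (\sum_(j < N) 2^-1)); last first.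
      by rewrite sumr_const card_ord -[leLHS]mulr_natl.
    apply: ler_sum => j _; apply: le_trans (pow_near_one (ltnW (ltn_ord j)) t2) _.
    by rewrite -dK ler_wpM2l// ltW.
  have := le_normcD (N%:R - \sum_(j < N) t ^+ j) (\sum_(j < N) t ^+ j).
  rewrite subrK normcMn normc1.
  have : 1 <= N%:R :> R by rewrite ler1n.
  lra.
have -> : t ^+ N - t ^+ k = t ^+ k * - (1 - t ^+ (N - k)).
  by rewrite opprB mulrBr mulr1 -exprD subnKC.
rewrite normcM normcN normcX -!mulrA ler_pM ?exprn_ge0 ?normc_ge0//.
  apply: (@le_trans _ _ (2 ^+ k)); first by rewrite lerXn2r ?nnegrE ?normc_ge0.
  by rewrite ler_weXn2l// ler1n.
apply: le_trans (pow_near_one (leq_subr k N) t2) _.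
by rewrite mulrA ler_wpM2l// ltW.
Qed.

(** The new root is s' = s t with t ^ N = z / z' and t near 1. The term of index k changes by z' c_k
    s ^ k (t ^ N - t ^ k), and |z'| |1 - z / z'| = |z' - z|, so the change is small however large z
    is. *)
Lemma perturbation (c : nat -> C) N (delta : R) : (0 < N)%N -> 0 < delta ->
  exists eps M : R, 0 < eps /\ forall z z' s : C, M < normc z ->
    normc (z' - z) < eps -> s ^+ N = z^-1 -> exists s' : C,
    [/\ z' != 0, s' ^+ N = z'^-1, normc s' < delta &
      normc (z * (\poly_(k < N.+1) c k).[s] - z' * (\poly_(k < N.+1) c k).[s'])
        < delta].
Proof.
move=> N0 d0; have [K [eta [K0 eta0 near1]]] := root_near_one N0.
pose S := \sum_(k < N.+1) normc (c k).
have S0 : 0 <= S by apply: sumr_ge0 => k _; exact: normc_ge0.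
pose eps := Num.min 1 (delta / (K * S + 1)).
have KS : 0 < K * S + 1 by rewrite ltr_wpDl// mulr_ge0// ltW.
have eps0 : 0 < eps by rewrite lt_min ltr01 divr_gt0.
(* The threshold gives |s| < 1, |s| < delta / 2 and |z'| > 1 / eta, so [near1] applies and |s t| <
   delta. *)
exists eps, (1 + eta^-1 + (delta / 2) ^- N); split=> // z z' s zM zz sz.
have eps1 : eps <= 1 by rewrite ge_min lexx.
have i1 : 0 < eta^-1 by rewrite invr_gt0.
have i2 : 0 < (delta / 2) ^- N by rewrite invr_gt0 exprn_gt0// divr_gt0.
have z'big : eta^-1 < normc z'.
  have := le_normcD z' (z - z'); rewrite addrC subrK -[z - z']opprB normcN; lra.
have z'0 : z' != 0 by rewrite -normc_gt0 (lt_trans _ z'big).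
have z0 : z != 0 by rewrite -normc_gt0; lra.
have nz' : 0 < normc z' by rewrite normc_gt0.
have aE : normc (1 - z / z') = normc (z' - z) / normc z'.
  by rewrite -normcV -normcM mulrBl divff.
have [|t tN [t2 tk]] := near1 (z / z').
  rewrite aE ltr_pdivrMr//; have := ltr_pM2l eta0 eta^-1 (normc z').
  rewrite z'big divff ?gt_eqF//; lra.
have s1 : normc s < 1 by apply: (normc_root_lt N0 ltr01 sz); rewrite expr1n invr1; lra.
have sd : normc s < delta / 2.
  by apply: (normc_root_lt N0 _ sz); rewrite ?divr_gt0//; lra.
exists (s * t); split=> //.
- by rewrite exprMn sz tN mulrA mulVf// mul1r.
- rewrite normcM; have := ler_wpM2l (normc_ge0 s) t2; lra.
- have -> : z * (\poly_(k < N.+1) c k).[s] - z' * (\poly_(k < N.+1) c k).[s * t] =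
      \sum_(k < N.+1) z' * (c k * s ^+ k * (t ^+ N - t ^+ k)).
    rewrite !horner_poly !mulr_sumr -sumrB; apply: eq_bigr => k _.
    rewrite exprMn tN; field; exact: z'0.
  apply: le_lt_trans (normc_sum _ _ _) _.
  apply: (@le_lt_trans _ _ (\sum_(k < N.+1) normc (c k) * (K * normc (z' - z)))).
    apply: ler_sum => k _; rewrite !normcM mulrCA -mulrA.
    rewrite ler_wpM2l ?normc_ge0//.
    apply: (@le_trans _ _ (1 * (normc z' * (K * normc (1 - z / z'))))).
      rewrite ler_pM ?mulr_ge0 ?normc_ge0//.
        by rewrite normcX exprn_ile1 ?normc_ge0// ltW.
      by rewrite ler_wpM2l ?normc_ge0// tk// -ltnS.
    by rewrite mul1r aE mulrCA (mulrCA (normc z')) divff ?mulr1// gt_eqF.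
  rewrite -mulr_suml -/S.
  have : eps * (K * S + 1) <= delta.
    by rewrite -ler_pdivlMr// ge_min lexx orbT.
  have := normc_ge0 (z' - z).
  have : normc (z' - z) * (K * S) <= eps * (K * S).
    by rewrite ler_wpM2r ?mulr_ge0// ltW.
  lra.
Qed.

End Roots.

(** * Infinity branches *)

Section Branches.
Local Open Scope classical_set_scope.
Local Open Scope complex_scope.
Variable R : realType.
Local Notation C := R[i].
Local Notation phi := (@fps_of_poly C \o (@polyC C \o real_complex R)).

(** The coefficient of index n of F(1, c, t ^ N) depends only on c modulo t ^ (n + 1), so truncation
    loses nothing. *)
Lemma puiseux_solutionP (f : {poly {poly R}}) (c : fps C) N :
  puiseux_solution f c N <-> homogenization f phi 1 c (Xps C N) = 0.
Proof.
have E n : homogenization f phi 1 c (Xps C N) n =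
    (homogenization f (polyC \o real_complex R) 1 (trunc n c) 'X^N)`_n.
  rewrite -[RHS]/(coefps (fps_of_poly _) n) homogenization_rmorph rmorph1.
  apply: (@homogenization_eqmod _ f _ phi n.+1) => // k kn.
  exact/esym/eqmod_trunc.
split=> [sol|sol n]; last by rewrite -[LHS]E sol.
by apply: fpsP => n; rewrite E; exact: sol.
Qed.

(** For w ^ N = 1, the conjugates are one power series evaluated at the different N-th roots of 1 /
    z. *)
Lemma series_conjugate_term (c : fps C) N w z n :
  series (conjugate_term c N w z) n = z * psum c (w / principal_root N z) n.
Proof.
rewrite seriesEord/= /psum mulr_sumr; apply: eq_bigr => k _.
by rewrite /conjugate_term expr_div_n; ring.
Qed.

Lemma conjugate_point N (w z : C) : (0 < N)%N -> z != 0 -> w ^+ N = 1 ->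
  (w / principal_root N z) ^+ N = z^-1.
Proof. by move=> N0 z0 w1; rewrite expr_div_n w1 principal_rootK// div1r. Qed.

Lemma cvg_conjugate_term (c : fps C) N w z v :
  psum c (w / principal_root N z) n @[n --> \oo] --> v ->
  series (conjugate_term c N w z) @ \oo --> z * v.
Proof.
move=> cv; rewrite (_ : series _ = fun n => z * psum c (w / principal_root N z) n).
  exact: (cvgM (cvg_cst z) cv).
by apply/funext => n; rewrite series_conjugate_term.
Qed.

Lemma lim_conjugate_term (c : fps C) N w z v :
  psum c (w / principal_root N z) n @[n --> \oo] --> v ->
  limn (series (conjugate_term c N w z)) = z * v.
Proof.
by move=> cv; apply: cvg_lim; [exact: norm_hausdorff|exact: cvg_conjugate_term].
Qed.

(** At a single point beyond the radius the terms of the convergent series are bounded, which bounds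
    the coefficients geometrically. *)
Lemma branch_convps f (B : infinity_branch f) : Fps (coefs B) \in @convps R.
Proof.
pose z : C := (Defs.radius B + 1)%:C.
have r0 := radius_gt0 B.
have [N0 _] := branch_ramif B.
have nz : normc z = Defs.radius B + 1.
  by rewrite /z/= expr0n addr0 sqrtr_sqr ger0_norm// addr_ge0// ltW.
have z0 : z != 0 by rewrite -normc_gt0 nz addr_gt0.
have cB : cvgn (series (conjugate_term (coefs B) (ramif B) 1 z)).
  by apply: branch_cvg; rewrite ?expr1n// nz ltrDl.
have /cvgcP/(_ 1 ltr01)[n0 _ small] := cvg_series_cvg_0 cB.
pose s := 1 / principal_root (ramif B) z.
have sz : s ^+ ramif B = z^-1 by rewrite conjugate_point// expr1n.
have s0 : 0 < normc s.
  rewrite normc_gt0; apply/eqP => s0; move: sz; rewrite s0 expr0n gtn_eqF//.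
  by move=> /esym/eqP; rewrite invr_eq0 (negbTE z0).
have nz0 : 0 < normc z by rewrite normc_gt0.
pose x k := normc (conjugate_term (coefs B) (ramif B) 1 z k).
have xE k : x k = normc z * normc (coefs B k) * normc s ^+ k.
  rewrite /x /conjugate_term expr1n -normcX -!normcM; congr normc.
  by rewrite /s expr_div_n expr1n; ring.
pose A := 1 + \sum_(k < n0) x k.
have x0 k : 0 <= x k by exact: normc_ge0.
have xA k : x k <= A.
  have [kn|nk] := ltnP k n0.
    by rewrite /A (bigD1 (Ordinal kn))//= addrCA lerDl addr_ge0// sumr_ge0.
  have := small k nk; rewrite sub0r normcN => /ltW/le_trans; apply.
  by rewrite lerDl sumr_ge0.
apply: (@convps_geo _ _ (A / normc z) (normc s)^-1); first by rewrite invr_gt0.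
move=> k /=; have := xA k; rewrite xE exprVn -ler_pdivlMr ?exprn_gt0//.
by rewrite -ler_pdivlMl// mulrA [_ * A]mulrC.
Qed.

(* The part of the branch that does not tend to 0 is z * trunc N c. *)
Lemma leaf_asymptotics (c : fps C) N w (e : R) : c \in @convps R ->
  (0 < N)%N -> w ^+ N = 1 -> 0 < e -> exists M : R, forall z : C, M < normc z ->
  normc (limn (series (conjugate_term c N w z)) -
         z * (trunc N c).[w / principal_root N z]) < e.
Proof.
move=> cc N0 w1 e0; pose d := c - fps_of_poly (trunc N c).
have cd : d \in @convps R by rewrite rpredB// convps_poly.
have [rho r0 [A bnd]] := convps_common cc cd.
have A0 : 0 <= A by have [/(le_trans (wnorm_ge0 _ _ (ltW r0)))] := bnd 0%N.
(* As |z| |s| ^ N = 1, the remainder |z| (|s| / rho) ^ (N + 1) A equals |s| A / rho ^ (N + 1), which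
   is below e for |s| < e'. The 1 in A + 1 guards against A = 0. *)
pose e' := Num.min rho (e * rho ^+ N.+1 / (A + 1)).
have e'0 : 0 < e'.
  by rewrite lt_min r0 divr_gt0 ?mulr_gt0 ?exprn_gt0// ltr_wpDl.
exists (e' ^- N) => z zM; set s := w / _.
have z0 : z != 0 by rewrite -normc_gt0 (lt_trans _ zM)// invr_gt0 exprn_gt0.
have sz : s ^+ N = z^-1 by exact: conjugate_point.
have := normc_root_lt N0 e'0 sz zM; rewrite lt_min => /andP[srho se].
have [v dv] := evaluates_exists r0 srho (fun k => (bnd k).2).
have cv : evaluates rho c s ((trunc N c).[s] + v).
  have := evaluatesD r0 (evaluates_poly s r0 (trunc N c)) dv.
  by rewrite addrC subrK.
rewrite (lim_conjugate_term cv.2) mulrDr addrAC subrr add0r normcM.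
have vle : normc v <= (normc s / rho) ^+ N.+1 * A.
  apply: (evaluates_le r0 srho dv (fun k => (bnd k).2)) => k kN.
  by rewrite coefpsB /= coef_poly kN subrr.
have zs : normc z * normc s ^+ N = 1.
  by rewrite -normcX -normcM sz mulfV// normc1.
apply: le_lt_trans (ler_wpM2l (normc_ge0 z) vle) _.
have -> : normc z * ((normc s / rho) ^+ N.+1 * A) = normc s * A / rho ^+ N.+1.
  rewrite expr_div_n exprS -!mulrA [normc s * (_ * _)]mulrCA (mulrA (normc z)) zs mul1r.
  by rewrite [_^-1 * A]mulrC.
rewrite ltr_pdivrMr ?exprn_gt0//; move: se; rewrite ltr_pdivlMr ?ltr_wpDl// => se.
apply: le_lt_trans se; rewrite ler_wpM2l ?normc_ge0//.
by rewrite lerDl.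
Qed.

Lemma leaf_on_curve (f : {poly {poly R}}) (c : fps C) N w : c \in @convps R ->
  homogenization f phi 1 c (Xps C N) = 0 -> (0 < N)%N -> w ^+ N = 1 ->
  exists M : R, forall z : C, M < normc z ->
  curve f (z, limn (series (conjugate_term c N w z))).
Proof.
move=> /convpsP[rho r0 [A bnd]] fc N0 w1; exists (rho ^- N) => z zM.
have z0 : z != 0 by rewrite -normc_gt0 (lt_trans _ zM)// invr_gt0 exprn_gt0.
have sz := conjugate_point N0 z0 w1.
have srho := normc_root_lt N0 r0 sz zM.
have [v cv] := evaluates_exists r0 srho bnd.
rewrite (lim_conjugate_term cv.2); apply/homogenization_y => //.
have e1 : evaluates rho 1 (w / principal_root N z) 1.
  by have := evaluates_poly (w / principal_root N z) r0 1; rewrite rmorph1 hornerC.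
have eX : evaluates rho (Xps C N) (w / principal_root N z) z^-1.
  by have := evaluates_poly (w / principal_root N z) r0 'X^N; rewrite hornerXn sz.
have ephi r : evaluates rho (phi r) (w / principal_root N z) (real_complex R r).
  by have := evaluates_poly (w / principal_root N z) r0 (real_complex R r)%:P; rewrite hornerC.
have := evaluates_homogenization r0 srho f ephi e1 cv eX.
rewrite fc => e0.
have := evaluates_poly (w / principal_root N z) r0 0; rewrite rmorph0 horner0.
exact: evaluates_unique e0.
Qed.

(** A solution found after dilations may have too large an index, while a branch requires the least
    one. The least common denominator d divides n, since a nonzero remainder of n modulo d would be
    a smaller one. *)
Lemma reduce_ramification (b : fps C) n : (0 < n)%N -> exists d g (c : fps C),
  [/\ (n = d * g.+1)%N, b = dilate g c & ramification_index c d].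
Proof.
move=> n0; pose Q d := (0 < d)%N && `[< forall k, b k != 0 -> (n %| d * k)%N >].
have Qn : exists d, Q d.
  by exists n; rewrite /Q n0; apply/asboolP => k _; exact: dvdn_mulr.
have [d /andP[d0 /asboolP Qd] dmin] := ex_minnP Qn.
have dn : (d %| n)%N.
  rewrite /dvdn -leqn0 leqNgt; apply/negP => r0.
  suff /dmin : Q (n %% d)%N by rewrite leqNgt ltn_mod d0.
  rewrite /Q r0; apply/asboolP => k /Qd nk.
  rewrite -(dvdn_addr (n %% d * k) (_ : n %| n %/ d * d * k)%N); last first.
    by rewrite -mulnA dvdn_mull.
  by rewrite -mulnDl -divn_eq dvdn_mulr.
have [g nE] := dvdnP dn.
have g0 : (0 < g)%N by move: n0; rewrite nE muln_gt0 => /andP[].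
pose c : fps C := Fps (fun k => b (k * g)%N).
exists d, g.-1, c; rewrite prednK//; split; first by rewrite mulnC.
  apply: fpsP => k /=; rewrite prednK//; case: ifP => [/divnK->//|gk].
  apply/eqP; apply: contraFT gk => /Qd.
  by rewrite nE [(g * d)%N]mulnC dvdn_pmul2l.
split=> // d' d'0 Qd'; apply: dmin; rewrite /Q d'0; apply/asboolP => k bk.
have /dvdnP[j kE] : (g %| k)%N by move: (Qd _ bk); rewrite nE [(g * d)%N]mulnC dvdn_pmul2l.
have := Qd' j; rewrite /= -kE => /(_ bk) dd.
by rewrite kE nE mulnA [(g * d)%N]mulnC dvdn_mul.
Qed.

Lemma branch_of_solution (f : {poly {poly R}}) (c : fps C) N :
  ramification_index c N -> c \in @convps R ->
  homogenization f phi 1 c (Xps C N) = 0 ->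
  exists B : infinity_branch f, ramif B = N /\ coefs B = c.
Proof.
move=> ram /convpsP[rho r0 [A bnd]] /puiseux_solutionP sol.
have N0 : (0 < N)%N by case: ram.
have pt : infinity_point f (c 0%N).
  have := sol 0%N; rewrite -horner_coef0 homogenization_horner.
  by rewrite hornerC hornerXn expr0n (gtn_eqF N0) horner_coef0 coef_poly.
have rad0 : 0 < rho ^- N by rewrite invr_gt0 exprn_gt0.
have cv w z : w ^+ N = 1 -> rho ^- N < normc z ->
    cvgn (series (conjugate_term c N w z)).
  move=> w1 zM; have z0 : z != 0 by rewrite -normc_gt0 (lt_trans _ zM).
  have srho := normc_root_lt N0 r0 (conjugate_point N0 z0 w1) zM.
  have [v cv] := psum_cvg r0 srho bnd.
  exact: (cvgP _ (cvg_conjugate_term cv)).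
by exists (InfinityBranch pt ram sol rad0 cv).
Qed.

End Branches.

(** * Approaching curves and convergent branches *)

Section Approach.
Local Open Scope classical_set_scope.
Local Open Scope complex_scope.
Variable R : realType.
Local Notation C := R[i].
Local Notation phi := (@fps_of_poly C \o (@polyC C \o real_complex R)).

Section LocalEquation.
Variables (f : {poly {poly R}}) (c : fps C) (N : nat).
Hypothesis N0 : (0 < N)%N.

(* The equation F(1, Y, t ^ N) = 0 after Y = trunc N c + t ^ N u, where
   t ^ N u is the part of the branch that stays bounded by u. *)
Definition local_equation : {poly {poly C}} :=
  homogenization f (polyC \o (polyC \o real_complex R)) 1
    ((trunc N c)%:P + ('X^N)%:P * 'X) ('X^N)%:P.

Lemma horner_local_equation u t : local_equation.[u%:P].[t] =
  homogenization f (real_complex R) 1 ((trunc N c).[t] + t ^+ N * u) (t ^+ N).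
Proof.
rewrite /local_equation !homogenization_horner.
by rewrite !(hornerD, hornerC, hornerCM, hornerM, hornerX, hornerXn).
Qed.

(** Otherwise, u being free, F(1, y, t ^ N) = 0 for all y and all t != 0. With y = 1 / t,
    homogeneity makes the polynomial F(X, 1, X ^ (N + 1)) zero, hence F(0, 1, 0) = 0. *)
Lemma local_equation_neq0 :
  homogenization f (real_complex R) 0 1 0 <> 0 -> local_equation != 0.
Proof.
move=> F010; apply/negP => /eqP H0; apply: F010.
pose p := homogenization f (polyC \o real_complex R) 'X 1 ('X^(N.+1)).
have p0 : p = 0.
  apply: infinite_roots => x x0; rewrite homogenization_horner hornerX hornerC hornerXn.
  have -> : homogenization f (real_complex R) x 1 (x ^+ N.+1) =
      x ^+ total_degree f * homogenization f (real_complex R) 1 x^-1 (x ^+ N).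
    by rewrite -homogenizationZ mulr1 divff// exprS.
  have := horner_local_equation ((x^-1 - (trunc N c).[x]) / x ^+ N) x.
  rewrite H0 !horner0 mulrCA divff ?expf_neq0// mulr1 addrC subrK => <-.
  by rewrite mulr0.
have := congr1 (horner^~ 0) p0; rewrite /p homogenization_horner horner0.
by rewrite hornerX hornerC hornerXn expr0n.
Qed.

(** The given points have t != 0, so the factor t ^ e cancels; P then vanishes at points tending to
    the origin, and continuity concludes. *)
Lemma local_equation_root e (P : {poly {poly C}}) :
  local_equation = ('X^e)%:P * P ->
  (forall delta : R, 0 < delta -> exists z t u : C,
     [/\ z != 0, t ^+ N = z^-1, normc t < delta, normc u < delta &
         curve f (z, z * (trunc N c).[t] + u)]) ->
  P.[0].[0] = 0.
Proof.
move=> HP near0; apply/eqP/negPn/negP => P00.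
have v0 : 0 < normc P.[0].[0] by rewrite normc_gt0.
have := @horner2_continuous R P (0, 0); move/cvgcP/(_ _ v0).
case=> -[U V] /= [/nbhs_norm0P[eU eU0 hU] /nbhs_norm0P[eV eV0 hV]] UV.
have real_part (x : C) : 0 < x -> x = (complex.Re x)%:C /\ 0 < complex.Re x.
  by case: x => a b; rewrite ltcE/= => /andP[/eqP -> a0].
have [eUE eUr] := real_part _ eU0; have [eVE eVr] := real_part _ eV0.
have d0 : 0 < Num.min (complex.Re eU) (complex.Re eV) by rewrite lt_min eUr.
have [z [t [u [z0 tz td ud zu]]]] := near0 _ d0.
move: td ud; rewrite !lt_min => /andP[tU _] /andP[_ uV].
have Ut : U t by apply: hU => /=; rewrite normrcE eUE ltcR.
have Vu : V u by apply: hV => /=; rewrite normrcE eVE ltcR.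
have := UV (t, u) (conj Ut Vu) => /=.
suff -> : P.[u%:P].[t] = 0 by rewrite subr0 ltxx.
have t0 : t != 0.
  apply/eqP => t0; move: tz; rewrite t0 expr0n gtn_eqF// => /esym/eqP.
  by rewrite invr_eq0 (negbTE z0).
have : local_equation.[u%:P].[t] = 0.
  rewrite horner_local_equation tz; apply/homogenization_y => //.
  by rewrite mulrDr mulrA divff// mul1r.
rewrite HP hornerCM hornerM hornerXn => /eqP.
by rewrite mulf_eq0 expf_eq0 (negbTE t0) andbF/= => /eqP.
Qed.

Lemma local_branch : homogenization f (real_complex R) 0 1 0 <> 0 ->
  (forall delta : R, 0 < delta -> exists z t u : C,
     [/\ z != 0, t ^+ N = z^-1, normc t < delta, normc u < delta &
         curve f (z, z * (trunc N c).[t] + u)]) ->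
  exists q u, [/\ u \in @convps R, u 0%N = 0 &
    homogenization f phi 1
      (dilate q (fps_of_poly (trunc N c)) + Xps C (N * q.+1) * u)
      (Xps C (N * q.+1)) = 0].
Proof.
move=> F010 near0.
have [e [P [HP P0]]] := poly2_primitive_part (local_equation_neq0 F010).
have P00 := local_equation_root HP near0.
pose h := map_poly (horner_eval 0) P.
have hE i : h`_i = P`_i`_0 by rewrite coef_map/= /horner_eval horner_coef0.
have hex : exists m, h`_m != 0.
  by exists (size h).-1; rewrite -lead_coefE lead_coef_eq0.
(* m is the multiplicity of the root u = 0 of P at t = 0. *)
have [m hm mmin] := ex_minnP hex.
have m0 : (0 < m)%N.
  rewrite lt0n; apply: contraNneq hm => ->.
  by rewrite hE -!horner_coef0 P00.
pose G := map_poly (@fps_of_poly C) P.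
have GE i : G`_i 0%N = h`_i by rewrite coef_map hE.
have [|||q [u [cu u0 Gu]]] := @puiseux_local R m G m0.
- by apply/polyOverP => i; rewrite coef_map convps_poly.
- move=> i im; rewrite GE; apply/eqP; apply: contraTT im => /mmin.
  by rewrite -leqNgt.
- by rewrite GE.
exists q, u; split=> //.
(* [psi] substitutes t ^ (q + 1) for t and the series found for the outer variable; being a ring
   morphism, it commutes with homogenization. *)
pose psi : {rmorphism {poly {poly C}} -> fps C} :=
  horner_eval u \o map_poly (dilate q \o @fps_of_poly C).
have psiC p : psi p%:P = dilate q (fps_of_poly p).
  by rewrite /psi/= map_polyC /horner_eval hornerC.
have psiX : psi 'X = u by rewrite /psi/= map_polyX /horner_eval hornerX.
have psiP : psi P = 0.
  by rewrite -Gu /psi/= /horner_eval /G map_poly_comp.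
have : psi local_equation = 0 by rewrite HP rmorphM [psi P]psiP mulr0.
rewrite homogenization_rmorph rmorphD rmorphM !psiC psiX rmorph1.
rewrite -[fps_of_poly 'X^N]/(Xps C N) dilate_Xps => <-.
apply: homogenization_eqphi => r.
exact/esym/(etrans (psiC (real_complex R r)%:P) (dilate_Cps q (real_complex R r))).
Qed.

End LocalEquation.

Lemma dist_to_ge0 (S : set (C * C)) p : 0 <= dist_to S p.
Proof.
have [->|/set0P S0] := eqVneq S set0.
  (* The infimum of the empty set is 0 by convention. *)
  by rewrite /dist_to image_set0 inf0.
apply: lb_le_inf; first by case: S0 => q Sq; exists (euclid_dist p q), q.
by move=> _ [q _ <-]; exact: sqrtr_ge0.
Qed.

Lemma dist_to_le (S : set (C * C)) z y y' : S (z, y') ->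
  dist_to S (z, y) <= normc (y' - y).
Proof.
move=> Sy; apply: ge_inf; first by exists 0 => _ [q _ <-]; exact: sqrtr_ge0.
exists (z, y') => //; rewrite /euclid_dist/= subrr normc0 expr0n add0r.
by rewrite sqrtr_sqr ger0_norm ?normc_ge0// -opprB normcN.
Qed.

(** For large z the leaf of [B'] over the same z lies on the curve of g, so the distance is squeezed
    between 0 and the difference of the leaves. *)
Lemma convergent_approaches (f g : {poly {poly R}}) (B : infinity_branch f)
    (B' : infinity_branch g) : convergent_branches B B' -> approaches (curve g) B.
Proof.
move=> [L [L' [BL [w' w'1 <-] /cvgc0P cLL]]]; exists L => //.
have [N0 _] := branch_ramif B'.
have := branch_solution B'.
rewrite -[coefs B']/(coefps (Fps (coefs B'))) => /puiseux_solutionP sol.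
have [M onc] := leaf_on_curve (branch_convps B') sol N0 w'1.
apply: (squeeze_cvgr _ (cvg_cst 0) cLL); exists M => z zM.
by rewrite dist_to_ge0 dist_to_le//=; exact: onc.
Qed.

(** The curve point nearest to the leaf point over a large real x lies over some z' close to x;
    [perturbation] transports the N-th root from 1 / x to 1 / z'. *)
Lemma approach_points (f fbar : {poly {poly R}}) (B : infinity_branch f) w
    (delta : R) : plane_curve fbar -> w ^+ ramif B = 1 -> 0 < delta ->
  dist_to (curve fbar)
    (z, limn (series (conjugate_term (coefs B) (ramif B) w z)))
    @[z --> @Cinfty_nbhs R] --> (0 : R) ->
  exists z t u : C, [/\ z != 0, t ^+ ramif B = z^-1, normc t < delta,
    normc u < delta &
    curve fbar (z, z * (trunc (ramif B) (Fps (coefs B))).[t] + u)].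
Proof.
move=> hfbar w1 d0 /cvgrPdist_lt dist0.
have [N0 _] := branch_ramif B.
set N := ramif B in N0 w1 dist0 *; set c := Fps (coefs B).
have d3 : 0 < delta / 3 by rewrite divr_gt0.
have [eps [M1 [eps0 pert]]] := perturbation c N0 d3.
have e0 : 0 < Num.min eps (delta / 3) by rewrite lt_min eps0.
have [M2 dist_small] := dist0 _ e0.
have [M3 asymp] := leaf_asymptotics (branch_convps B) N0 w1 d3.
pose x : R := 1 + `|M1| + `|M2| + `|M3|.
have n1 := normr_ge0 M1; have n2 := normr_ge0 M2; have n3 := normr_ge0 M3.
have l1 := ler_norm M1; have l2 := ler_norm M2; have l3 := ler_norm M3.
have [xM M1x M2x M3x] : [/\ 0 < x, M1 < x, M2 < x & M3 < x].
  by rewrite /x; split; lra.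
have nx : normc x%:C = x by rewrite /= expr0n addr0 sqrtr_sqr gtr0_norm.
have x0 : x%:C != 0 by rewrite -normc_gt0 nx.
have := dist_small x%:C; rewrite nx => /(_ M2x).
rewrite sub0r normrN ger0_norm ?dist_to_ge0// => dx.
have := asymp x%:C; rewrite nx => /(_ M3x) ax.
set y := limn _ in dx ax.
have [[z' y'] Cq [qE _]] := dist_to_min (x%:C, y) hfbar.
have := euclid_dist_ge (x%:C, y) (z', y'); rewrite qE /= => -[zd yd].
have := pert x%:C z' (w / principal_root N x%:C); rewrite nx => /(_ M1x).
have zd' : normc (z' - x%:C) < eps.
  rewrite -opprB normcN; apply: le_lt_trans zd _; apply: lt_le_trans dx _.
  by rewrite ge_min lexx.
move=> /(_ zd' (conjugate_point N0 x0 w1))[t [z'0 tz td hd]].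
exists z', t, (y' - z' * (trunc N c).[t]); split=> //.
- by apply: lt_trans td _; lra.
- have yd' : normc (y' - y) < delta / 3.
    rewrite -opprB normcN; apply: le_lt_trans yd _; apply: lt_le_trans dx _.
    by rewrite ge_min lexx orbT.
  set s := w / _ in ax hd.
  (* Three errors below delta / 3: the distance to the curve, the tail of the leaf, and the passage
     from x to z'. *)
  have -> : y' - z' * (trunc N c).[t] = (y' - y) + ((y - x%:C * (trunc N c).[s])
     + (x%:C * (trunc N c).[s] - z' * (trunc N c).[t])) by ring.
  have h1 := le_normcD (y' - y) ((y - x%:C * (trunc N c).[s])
     + (x%:C * (trunc N c).[s] - z' * (trunc N c).[t])).
  have h2 := le_normcD (y - x%:C * (trunc N c).[s])
     (x%:C * (trunc N c).[s] - z' * (trunc N c).[t]).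
  rewrite -/(trunc N c) in hd; lra.
- by rewrite addrC subrK.
Qed.

Lemma approaches_convergent (f g : {poly {poly R}}) (B : infinity_branch f) :
  plane_curve g -> approaches (curve g) B ->
  exists B' : infinity_branch g, convergent_branches B B'.
Proof.
move=> hg [L [w w1 <-] dist0].
have [N0 _] := branch_ramif B.
set N := ramif B in N0 w1 *; pose c := Fps (coefs B).
have near0 delta (d0 : 0 < delta) := approach_points hg w1 d0 dist0.
have [q [u [cu u0 sol]]] := local_branch N0 hg.2 near0.
set b := dilate q _ + _ in sol.
have cb : b \in @convps R.
  by rewrite rpredD ?convps_dilate ?convps_poly// rpredM ?convps_X.
have Nq0 : (0 < N * q.+1)%N by rewrite muln_gt0 N0.
have [d [g' [a [nE bE ram]]]] := reduce_ramification b Nq0.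
have ca : a \in @convps R.
  have [A [r [A0 r1 br]]] := convps_geoP cb.
  apply: (@convps_geo _ _ A (r ^+ g'.+1)).
    by rewrite exprn_gt0// (lt_le_trans ltr01).
  by move=> k; rewrite -(coef_dilate_mul g' a k) -bE -exprM mulnC.
have sola : homogenization g phi 1 a (Xps C d) = 0.
  apply: (@dilate_inj _ g'); rewrite rmorph0 -sol homogenization_rmorph.
  rewrite rmorph1 bE nE -dilate_Xps.
  by apply: homogenization_eqphi => r; exact: dilate_Cps.
have [B' [rB' cB']] := branch_of_solution ram ca sola.
(* The leaf of the new branch has to match w: with x ^ (q + 1) = w, the point t = x / z ^ (1 / (N (q
   + 1))) satisfies t ^ (q + 1) = s, so both leaves share the part z Phi. *)
have [x xq] := @exists_root R q.+1 w isT.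
have xd : (x ^+ g'.+1) ^+ d = 1.
  by rewrite -exprM mulnC -nE mulnC exprM xq.
exists B'.
exists (Leaf (Defs.radius B) (fun z => limn (series (conjugate_term (coefs B) N w z)))).
exists (Leaf (Defs.radius B') (fun z => limn (series (conjugate_term a d (x ^+ g'.+1) z)))).
split; [by exists w | by exists (x ^+ g'.+1); rewrite ?rB' ?cB' |].
rewrite /convergent_leaves/=; apply/cvgcP => e e0.
have e2 : 0 < e / 2 by rewrite divr_gt0.
have [M1 asymp] := leaf_asymptotics (branch_convps B) N0 w1 e2.
have [rho r0 [A bnd]] := convps_common cb cu.
have A0 : 0 <= A by have [/(le_trans (wnorm_ge0 _ _ (ltW r0)))] := bnd 0%N.
(* Since u has no constant term, |u(t)| <= |t| A / rho, which is below e / 2 for |t| < e'. *)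
pose e' := Num.min rho (e / 2 * rho / (A + 1)).
have e'0 : 0 < e'.
  by rewrite lt_min r0 divr_gt0 ?mulr_gt0// ltr_wpDl.
exists (Num.max M1 (e' ^- (N * q.+1))) => z; rewrite gt_max => /andP[zM1 zM].
have z0 : z != 0 by rewrite -normc_gt0 (lt_trans _ zM)// invr_gt0 exprn_gt0.
have {}asymp := asymp z zM1.
set s := w / _ in asymp.
pose t := x / principal_root (N * q.+1) z.
have tq : t ^+ q.+1 = s by rewrite /t expr_div_n xq principal_rootX.
have tg : t ^+ g'.+1 = x ^+ g'.+1 / principal_root d z.
  by rewrite /t expr_div_n nE principal_rootX.
have tz : t ^+ (N * q.+1) = z^-1.
  by rewrite mulnC exprM tq conjugate_point.
have := normc_root_lt Nq0 e'0 tz zM; rewrite lt_min => /andP[trho te].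
have [v uv] := evaluates_exists r0 trho (fun k => (bnd k).2).
(* Multiplied by z, this value gives z Phi(s) + v for the new leaf. *)
have bv : evaluates rho b t ((trunc N c).[s] + z^-1 * v).
  apply: (evaluatesD r0); last first.
    apply: (evaluatesM r0 trho _ uv).
    by have := evaluates_poly t r0 'X^(N * q.+1); rewrite hornerXn tz.
  rewrite dilate_poly.
  by have := evaluates_poly t r0 (trunc N c \Po 'X^(q.+1)); rewrite horner_comp hornerXn tq.
have av : psum a (x ^+ g'.+1 / principal_root d z) n @[n --> \oo] -->
    (trunc N c).[s] + z^-1 * v.
  (* As b is a dilation of a, the partial sums of a form a subsequence of those of b. *)
  rewrite -tg (_ : psum a _ = (fun n => psum b t (n * g'.+1))).
    apply: (cvg_comp (fun n => (n * g'.+1)%N) (psum b t) _ bv.2).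
    move=> U [n0 _ n0U]; exists n0 => // n /= n0n; apply: n0U => /=.
    by apply: leq_trans n0n _; rewrite leq_pmulr.
  by apply/funext => n; rewrite bE psum_dilate.
rewrite (lim_conjugate_term av).
have vle : normc v <= normc t / rho * A.
  rewrite -[_ / rho]expr1; apply: (evaluates_le r0 trho uv (fun k => (bnd k).2)).
  by case.
have vsmall : normc v < e / 2.
  apply: le_lt_trans vle _; rewrite mulrAC ltr_pdivrMr//.
  move: te; rewrite ltr_pdivlMr ?ltr_wpDl// => te.
  apply: le_lt_trans te; rewrite ler_wpM2l ?normc_ge0//.
  by rewrite lerDl.
set l := limn _ in asymp *.
rewrite mulrDr mulrA divff// mul1r.
have -> : 0 - (z * (trunc N c).[s] + v - l) = (l - z * (trunc N c).[s]) + - v by ring.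
have := le_normcD (l - z * (trunc N c).[s]) (- v).
rewrite normcN; lra.
Qed.

End Approach.

Theorem theorem4p11 (R : realType) (f fbar : {poly {poly R}})
    (hf : plane_curve f) (hfbar : plane_curve fbar) (B : infinity_branch f) :
  approaches (curve fbar) B <->
  exists Bbar : infinity_branch fbar, convergent_branches B Bbar.
Proof.
split; first exact: approaches_convergent.
by move=> [Bbar]; exact: convergent_approaches.
Qed.
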